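(* Let each $g_i:\mathbb{R}^n\to\mathbb{R}$, $i=1,\dots,n_{\rm g}$, be concave, let $C=\{x\in\mathbb{R}^n : g(x)\ge 0\}$ (which is then convex), and assume that Slater's condition holds (there is $x$ with $g_i(x)>0$ for all $i$). Let $f:\mathbb{R}^n\to\mathbb{R}$ be $1$-smooth and either convex or strongly convex with strong convexity constant $\mu>0$. Let the parameters $\alpha,\delta,\beta$ (possibly depending on time) and the rate $\rho$ be given by one of the following choices: (i) (heavy ball; $f$ $\mu$-strongly convex, $\mu>0$) $\alpha=\sqrt{\mu}$, $\delta=\sqrt{\mu}$, $\beta=0$, $\rho(t)=e^{-\sqrt{\mu}\,t}$; (ii) (Nesterov, constant parameters; $f$ $\mu$-strongly convex, $\mu>0$) $\alpha=\sqrt{\mu}-\mu/2$, $\delta=\frac{\sqrt\mu}{1+\sqrt\mu}$, $\beta=\frac{1-\sqrt\mu}{1+\sqrt\mu}$, $\rho(t)=e^{-(\sqrt\mu-\mu/2)t}$; (iii) (Nesterov, varying parameters; $f$ convex) $\alpha(t)=\frac{2}{t+3}$, $\delta(t)=\frac{3}{2(t+3)}$, $\beta(t)=\frac{t}{t+3}$, $\rho(t)=\frac{9}{(t+3)^2}$. Let $(x(t),u(t))$, $t\ge0$, be a trajectory satisfying $$\mathrm{d}u+2\delta u\,\mathrm{d}t+\nabla f(x+\beta u)\,\mathrm{d}t=\sum_{i\in I_x}\nabla g_i(x)\,\mathrm{d}\lambda_i,\qquad \gamma_i^+ +\epsilon\gamma_i^-\in N_{\mathbb{R}_{\le 0}}(-\mathrm{d}\lambda_i),\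 i\in I_x,\qquad \mathrm{d}x=u\,\mathrm{d}t,$$ with arbitrary $x(0)\in\mathbb{R}^n$ and $u(0)=0$. Then, for all $t\ge 0$, $$\min\{0,g(x(0))\}^{T}\lambda^*\,\rho(t)\ \le\ f(x(t))-f(x^* )\ \le\ \Big(\frac{\alpha(0)^2}{2}|x(0)-x^*|^2+f(x(0))-f(x^* )\Big)\rho(t),$$ where $x^*$ is a minimizer of $f$ over $C$ and $\lambda^*$ is a multiplier that satisfies the Karush-Kuhn-Tucker conditions.
   Context: Standing assumptions: $f$ is coercive and $C$ is compact; $g$ is smooth (differentiable with Lipschitz gradients); $\epsilon\in[0,1)$ is a constant. $1$-smooth means differentiable with $1$-Lipschitz gradient. The minimum $\min\{0,g(x(0))\}$ is taken componentwise; $|\cdot|$ is the Euclidean norm. Notation: $I_x:=\{i\in\{1,\dots,n_{\rm g}\} : g_i(x)\le 0\}$; $\gamma_i(x,u):=\nabla g_i(x)^{T}u+\alpha g_i(x)$ (with $\alpha=\alpha(t)$ when it is time-varying); $\gamma_i^\pm:=\gamma_i(x(t),u(t)^\pm)$, where $u(t)^\pm$ are the right/left limits of $u$ at $t$. $N_{\mathbb{R}_{\le0}}$ is the normal cone of $\mathbb{R}_{\le 0}$, so $a\in N_{\mathbb{R}_{\le 0}}(-b)$ iff $a\ge 0$, $b\ge 0$, $ab=0$. Meaning of the inclusion (understood in the sense of integration of measures): $x$ is locally absolutely continuous with $\mathrm{d}x=u\,\mathrm{d}t$; $u$ is of locally bounded variation without singular part (a sum of an absolutely continuous function and a piecewise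 constant step function), has left and right limits at every $t$, and need not be defined at its discontinuity points; initial values are understood as left limits (so $u(0)^-=0$). Writing $\mathrm{d}u=\dot u\,\mathrm{d}t+(u^+-u^-)\,\mathrm{d}\eta$ and $\mathrm{d}\lambda_i=\lambda_i(t)\,\mathrm{d}t+\Lambda_i(t)\,\mathrm{d}\eta$, with $\mathrm{d}\eta$ the atomic measure, the inclusion means: (i) for almost every $t\ge 0$, $\dot u+2\delta u+\nabla f(x+\beta u)=\sum_{i\in I_{x(t)}}\nabla g_i(x)\lambda_i$ with $\lambda_i\ge0$, $\gamma_i\ge 0$, $\lambda_i\gamma_i=0$ for all $i\in I_{x(t)}$; (ii) at every $t$, in particular at every discontinuity of $u$, $u(t)^+-u(t)^-=\sum_{i\in I_{x(t)}}\nabla g_i(x(t))\Lambda_i$ with $\Lambda_i\ge 0$, $\gamma_i^++\epsilon\gamma_i^-\ge 0$, $\Lambda_i(\gamma_i^++\epsilon\gamma_i^-)=0$ for all $i\in I_{x(t)}$. Karush-Kuhn-Tucker conditions: $\lambda^*\ge 0$, $\nabla f(x^* )=\sum_i\nabla g_i(x^* )\lambda_i^*$, $\lambda_i^*g_i(x^* )=0$ for all $i$. *)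

(* Defs.v *)
(* The real line is an arbitrary [R : realType] and R^n is
   ['rV[R]_n].  The library norm on ['rV[R]_n] is the sup norm: it is used only
   through the topology and the notion of differentiability, which do not
   depend on the choice of a norm; [enorm] below is the Euclidean norm. *)
From HB Require Import structures.
From mathcomp Require Import all_boot all_order all_algebra.
From mathcomp Require Import all_classical all_reals all_analysis.

Set Implicit Arguments.
Unset Strict Implicit.
Unset Printing Implicit Defensive.

Import Order.TTheory GRing.Theory Num.Theory.
Import numFieldNormedType.Exports.

Local Open Scope classical_set_scope.
Local Open Scope ring_scope.

Section Euclidean.
Context {R : realType} {n : nat}.
Implicit Types (u v x y : 'rV[R]_n) (f : 'rV[R]_n -> R).

Definition dotr u v : R := \sum_(j < n) u 0 j * v 0 j.

Definition enorm u : R := Num.sqrt (dotr u u).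

Definition grad f x : 'rV[R]_n := \row_(j < n) 'D_(delta_mx 0 j) f x.

Definition smooth (L : R) f : Prop :=
  (forall x, differentiable f x) /\
  (forall x y, enorm (grad f x - grad f y) <= L * enorm (x - y)).

Definition coercive f : Prop :=
  forall M : R, exists r : R, forall x, r <= enorm x -> M <= f x.

Definition convex_fun f : Prop := convex_function [set: 'rV[R]_n] f.

Definition concave_fun f : Prop := convex_fun (fun x => - f x).

Definition strongly_convex (mu : R) f : Prop :=
  forall (t : R) x y, 0 <= t <= 1 ->
    f (t *: x + (1 - t) *: y) <=
      t * f x + (1 - t) * f y - mu / 2 * (t * (1 - t)) * enorm (x - y) ^+ 2.

End Euclidean.

Section Scheme.
Context {R : realType}.

Record parameters := MkParams {
  alpha : R -> R;
  delta : R -> R;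
  beta : R -> R;
  rate : R -> R }.

Definition heavy_ball (mu : R) : parameters :=
  {| alpha := fun=> Num.sqrt mu;
     delta := fun=> Num.sqrt mu;
     beta := fun=> 0;
     rate := fun t => expR (- Num.sqrt mu * t) |}.

Definition nesterov_constant (mu : R) : parameters :=
  {| alpha := fun=> Num.sqrt mu - mu / 2;
     delta := fun=> Num.sqrt mu / (1 + Num.sqrt mu);
     beta := fun=> (1 - Num.sqrt mu) / (1 + Num.sqrt mu);
     rate := fun t => expR (- (Num.sqrt mu - mu / 2) * t) |}.

Definition nesterov_varying : parameters :=
  {| alpha := fun t => 2 / (t + 3);
     delta := fun t => 3 / (2 * (t + 3));
     beta := fun t => t / (t + 3);
     rate := fun t => 9 / (t + 3) ^+ 2 |}.

Definition admissible (n : nat) (f : 'rV[R]_n -> R) (p : parameters) : Prop :=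
  (exists mu : R, [/\ 0 < mu, strongly_convex mu f &
     p = heavy_ball mu \/ p = nesterov_constant mu]) \/
  (convex_fun f /\ p = nesterov_varying).

End Scheme.
Arguments parameters : clear implicits.

Section Program.
Context {R : realType} {n ng : nat}.
Implicit Types (f : 'rV[R]_n -> R) (g : 'I_ng -> 'rV[R]_n -> R) (x : 'rV[R]_n).

Definition feasible g : set 'rV[R]_n := [set x | forall i, 0 <= g i x].

Definition slater g : Prop := exists x, forall i, 0 < g i x.

Definition minimizer_over f (C : set 'rV[R]_n) x : Prop :=
  C x /\ forall y, C y -> f x <= f y.

Definition KKT f g x (lambda : 'I_ng -> R) : Prop :=
  [/\ forall i, 0 <= lambda i,
      grad f x = \sum_(i < ng) lambda i *: grad (g i) x &
      forall i, lambda i * g i x = 0].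

(* The index set I_x; it also contains the violated constraints. *)
Definition active g x : pred 'I_ng := fun i => g i x <= 0.

End Program.

Section Measures.
Context {R : realType}.

Definition loc_integrable (h : R -> R) : Prop :=
  forall T : R, 0 <= T -> lebesgue_measure.-integrable `[0, T] (EFin \o h).

Definition loc_summable (h : R -> R) : Prop :=
  forall T : R, 0 <= T -> summable `[0, T] (EFin \o h).

(* The integral of h over A with respect to the atomic measure d\eta.  Under
   [loc_summable] h vanishes outside a countable set of times, which may have
   accumulation points (infinitely many impacts in finite time). *)
Definition atomic_sum (A : set R) (h : R -> R) : R :=
  fine (\esum_(s in A) (EFin \o h)^\+ s - \esum_(s in A) (EFin \o h)^\- s)%E.

End Measures.

Section Dynamics.
Context {R : realType} {n ng : nat}.

Definition gamma (a : R) (gi : 'rV[R]_n -> R) (x u : 'rV[R]_n) : R :=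
  dotr (grad gi x) u + a * gi x.

(* The measure differential inclusion, for functions of time that matter only
   on [0, +oo[.  [up t] and [um t] are the right and left limits u(t)^+ and
   u(t)^-; since there is no time before 0, [um 0] is the prescribed initial
   velocity u(0)^-, and a jump at time 0 is allowed.  The values of u itself at
   its (countably many) discontinuities are irrelevant.

   A differential measure is given by its values on compact intervals:
   dx([a, b]) = x(b) - x(a) and du([a, b]) = u(b)^+ - u(a)^-.  The equality
   dx = u dt thus says that x is a Lebesgue primitive of u, hence locally
   absolutely continuous, and du = udot dt + (u^+ - u^-) d\eta says that u is,
   up to its values at discontinuities, a locally absolutely continuous
   function plus a step function, without singular part.  Likewise
   d\lambda_i = lam_i dt + Lam_i d\eta is a locally finite measure. *)
Record inclusion (f : 'rV[R]_n -> R) (g : 'I_ng -> 'rV[R]_n -> R)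
    (p : parameters R) (eps : R)
    (x u up um udot : R -> 'rV[R]_n) (lam Lam : 'I_ng -> R -> R) : Prop :=
  Inclusion {
  u_right : forall t : R, 0 <= t -> u s @[s --> t^'+] --> up t;
  u_left : forall t : R, 0 < t -> u s @[s --> t^'-] --> um t;
  u_integrable : forall j, loc_integrable (fun t => u t 0 j);
  dx_eq : forall (a b : R) j, 0 <= a -> a <= b ->
    x b 0 j - x a 0 j = \int[lebesgue_measure]_(s in `[a, b]) u s 0 j;
  udot_integrable : forall j, loc_integrable (fun t => udot t 0 j);
  jump_summable : forall j, loc_summable (fun t => (up t - um t) 0 j);
  du_eq : forall (a b : R) j, 0 <= a -> a <= b ->
    up b 0 j - um a 0 j =
      \int[lebesgue_measure]_(s in `[a, b]) udot s 0 j
      + atomic_sum `[a, b] (fun s => (up s - um s) 0 j);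
  lam_integrable : forall i, loc_integrable (lam i);
  Lam_summable : forall i, loc_summable (Lam i);
  flow : {ae lebesgue_measure, forall t : R, 0 <= t ->
    udot t + (2 * delta p t) *: u t + grad f (x t + beta p t *: u t)
      = \sum_(i < ng | active g (x t) i) lam i t *: grad (g i) (x t) /\
    forall i, active g (x t) i ->
      let gam := gamma (alpha p t) (g i) (x t) (u t) in
      [/\ 0 <= lam i t, 0 <= gam & lam i t * gam = 0]};
  impact : forall t : R, 0 <= t ->
    up t - um t
      = \sum_(i < ng | active g (x t) i) Lam i t *: grad (g i) (x t) /\
    forall i, active g (x t) i ->
      let gam := gamma (alpha p t) (g i) (x t) (up t)
                 + eps * gamma (alpha p t) (g i) (x t) (um t) in
      [/\ 0 <= Lam i t, 0 <= gam & Lam i t * gam = 0] }.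

End Dynamics.

(* Main.v *)
Require Import Defs.
From HB Require Import structures.
From mathcomp Require Import all_boot all_order all_algebra.
From mathcomp Require Import all_classical all_reals all_analysis.
From mathcomp Require Import ring lra.

Import Order.TTheory GRing.Theory Num.Theory.
Import numFieldNormedType.Exports.

Set Implicit Arguments.
Unset Strict Implicit.
Unset Printing Implicit Defensive.

Local Open Scope classical_set_scope.
Local Open Scope ring_scope.

(** Let [z = x - xstar], [w = alpha z + u] and
    [E = |w|^2 / 2 + f x - f xstar].  The upper bound says that [E / rate] does
    not increase along trajectories, and the lower bound that no violated
    constraint [g_i] decays more slowly than [rate].

    Between impacts, the reaction [v] of the constraints satisfies [v . w <= 0]:
    concavity gives [grad g_i . z <= g_i], whence
    [grad g_i . w <= gamma_i], and [lam_i gamma_i = 0].  What is left of the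
    derivative of [E] is estimated with three instances of the strong convexity
    of [f], between the points [x], [x + beta u] and [xstar] ([lyapunov_flow]).
    Up to a multiple of [(grad f x - grad f (x + beta u)) . u], which is
    nonpositive by monotonicity, the terms in [grad f] cancel, and
    [E' + alpha E] is at most a quadratic form in [(z, u)], which each of the
    three choices of parameters makes nonpositive (the conditions collected in
    [lyapunov_parameters]).  At an impact with velocity jump [D], the change of
    [E] is at most [(1 - eps) / 2] times the sum of the [Lam_i gamma_i^-], and
    this sum is [- |D|^2 / (1 + eps)] ([lyapunov_jump]).  Since the rate is the
    exponential of minus the integral of [alpha], the upper bound follows.  For
    the lower bound, [gamma_i >= 0] says that
    [g_i x / rate] does not decrease while [g_i x < 0]; then
    [f x - f xstar >= sum_i lambdastar_i g_i x] by convexity and the KKT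
    conditions.

    The velocity may jump infinitely often in finite time, and the inclusion
    only holds almost everywhere, so pointwise derivatives are of little
    help.  The increments of [E / rate] over a short open interval are bounded
    by those of the velocity, the position and the time, with
    coefficients that vary little, because the velocity has one-sided limits.
    The increments of the three integrators are integrals and sums of atoms,
    over which the pointwise inequalities can be integrated; the error is a
    small multiple of the total variation ([sum_increment_le]).  Such local
    estimates add up to a global one by an argument on suprema
    ([local_to_global]). *)

(** * Sums of atoms *)

Section AtomicSums.
Context {R : realType}.
Implicit Types (A B : set R) (h p q : R -> R).

Lemma summable_subset A B h : A `<=` B ->
  summable B (EFin \o h) -> summable A (EFin \o h).
Proof.
move=> AB; apply: le_lt_trans.
rewrite [leRHS](esumID A)// (_ : B `&` A = A); last exact/setIidPr.
by rewrite leeDl// esum_ge0.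
Qed.

Lemma summable_le A p h : (forall s, `|p s| <= `|h s|) ->
  summable A (EFin \o h) -> summable A (EFin \o p).
Proof.
by move=> ph; apply: le_lt_trans; apply: le_esum => s As; rewrite lee_fin ph.
Qed.

Lemma summable_add A p q : summable A (EFin \o p) -> summable A (EFin \o q) ->
  summable A (EFin \o (fun s => p s + q s)).
Proof. exact: summableD. Qed.

Lemma esum_scale A c p : 0 <= c -> (forall s, 0 <= p s) ->
  (\esum_(x in A) (c * p x)%:E <= c%:E * \esum_(x in A) (p x)%:E)%E.
Proof.
move=> c0 p0; apply: ge_ereal_sup => _ [X [finX XA] <-].
under eq_fsbigr do rewrite EFinM.
rewrite -ge0_mule_fsumr//.
apply: lee_wpmul2l; first by rewrite lee_fin.
by apply: ereal_sup_ubound; exists X.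
Qed.

Lemma summable_scale A c h : summable A (EFin \o h) ->
  summable A (EFin \o (fun s => c * h s)).
Proof.
move=> sh; rewrite /summable.
apply: (@le_lt_trans _ _ (`|c|%:E * \esum_(x in A) `|(EFin \o h) x|)%E).
  apply: le_trans (esum_scale _ _ _) => //.
  by apply: le_esum => s _; rewrite /= normrM.
by move: sh; rewrite summableE => /fineK <-; rewrite -EFinM ltry.
Qed.

Definition pos_sum A p : R := fine (\esum_(s in A) (p s)%:E)%E.

Lemma esum_fin_num A p : (forall s, 0 <= p s) -> summable A (EFin \o p) ->
  (\esum_(s in A) (p s)%:E \is a fin_num)%E.
Proof.
move=> p0; rewrite summableE; congr (_ \is a fin_num).
by apply: eq_esum => s _ /=; rewrite ger0_norm.
Qed.

Lemma pos_sum_ge0 A p : (forall s, 0 <= p s) -> 0 <= pos_sum A p.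
Proof. by move=> p0; rewrite fine_ge0// esum_ge0// => s _; rewrite lee_fin. Qed.

Lemma pos_sumD A p q : (forall s, 0 <= p s) -> (forall s, 0 <= q s) ->
  summable A (EFin \o p) -> summable A (EFin \o q) ->
  pos_sum A (fun s => p s + q s) = pos_sum A p + pos_sum A q.
Proof.
move=> p0 q0 sp sq; rewrite /pos_sum -fineD ?esum_fin_num//.
by rewrite -esumD// => s _; rewrite lee_fin.
Qed.

Lemma pos_sumZ A c p : 0 <= c -> (forall s, 0 <= p s) ->
  summable A (EFin \o p) -> pos_sum A (fun s => c * p s) = c * pos_sum A p.
Proof.
have le_scale d q : 0 <= d -> (forall s, 0 <= q s) -> summable A (EFin \o q) ->
    pos_sum A (fun s => d * q s) <= d * pos_sum A q.
  move=> d0 q0 sq; rewrite /pos_sum -lee_fin EFinM !fineK ?esum_fin_num//.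
  - exact: esum_scale.
  - by move=> s; rewrite mulr_ge0.
  - exact: summable_scale.
move=> c0 p0 sp; apply/eqP; rewrite eq_le le_scale//=.
have [->|cn0] := eqVneq c 0.
  by rewrite mul0r pos_sum_ge0// => s; rewrite mul0r.
have {cn0} c_gt0 : 0 < c by rewrite lt_def cn0.
rewrite -ler_pdivlMl//; apply: le_trans (le_scale _ _ _ _ _).
- by under eq_fun do rewrite mulrA mulVf ?gt_eqF// mul1r.
- by rewrite invr_ge0 ltW.
- by move=> s; rewrite mulr_ge0// ltW.
- exact: summable_scale.
Qed.

Lemma pos_sum_disjoint A B p : (forall s, 0 <= p s) -> [disjoint A & B] ->
  summable (A `|` B) (EFin \o p) ->
  pos_sum (A `|` B) p = pos_sum A p + pos_sum B p.
Proof.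
move=> p0 AB sp; rewrite /pos_sum -fineD.
- rewrite (esumID A); last by move=> s _; rewrite lee_fin.
  congr fine; congr (_ + _)%E; congr esum; first by rewrite setUK.
  move: AB => /disj_setPS AB; apply/seteqP; split => s /=.
    by case=> [[As|Bs]] nAs.
  by move=> Bs; split; [right|move=> As; exact: (AB s)].
- by apply: esum_fin_num => //; apply: summable_subset sp; exact: subsetUl.
- by apply: esum_fin_num => //; apply: summable_subset sp; exact: subsetUr.
Qed.

(** The value of a signed sum does not depend on the way in which it is split
    into a difference of two sums of nonnegative terms, which is what makes it
    linear. *)
Lemma atomic_sum_diff A p q : (forall s, 0 <= p s) -> (forall s, 0 <= q s) ->
  summable A (EFin \o p) -> summable A (EFin \o q) ->
  atomic_sum A (fun s => p s - q s) = pos_sum A p - pos_sum A q.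
Proof.
move=> p0 q0 sp sq; rewrite /atomic_sum /pos_sum -fineB ?esum_fin_num//.
have -> : EFin \o (fun s => p s - q s) = ((EFin \o p) \- (EFin \o q))%E by [].
by rewrite esumB// => s _ /=; rewrite lee_fin.
Qed.

Let pos h s := Num.max (h s) 0.
Let neg h s := Num.max (- h s) 0.

Let posneg h : h = fun s => pos h s - neg h s.
Proof.
apply/funext => s; rewrite /pos /neg.
by case: (leP (h s)); case: (leP (- h s)); lra.
Qed.
Let pos_ge0 h s : 0 <= pos h s. Proof. by rewrite /pos le_max lexx orbT. Qed.
Let neg_ge0 h s : 0 <= neg h s. Proof. by rewrite /neg le_max lexx orbT. Qed.
Let pos_summable A h : summable A (EFin \o h) -> summable A (EFin \o pos h).
Proof.
apply: summable_le => s; rewrite (ger0_norm (pos_ge0 h s)) /pos ge_max.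
by rewrite ler_norm normr_ge0.
Qed.
Let neg_summable A h : summable A (EFin \o h) -> summable A (EFin \o neg h).
Proof.
apply: summable_le => s; rewrite (ger0_norm (neg_ge0 h s)) /neg ge_max.
by rewrite -normrN ler_norm normr_ge0.
Qed.
Let atomic_sum_posneg A h : summable A (EFin \o h) ->
  atomic_sum A h = pos_sum A (pos h) - pos_sum A (neg h).
Proof.
move=> sh; rewrite {1}(posneg h) atomic_sum_diff//.
  exact: pos_summable.
exact: neg_summable.
Qed.

Lemma atomic_sum_ge0E A h : (forall s, 0 <= h s) -> summable A (EFin \o h) ->
  atomic_sum A h = pos_sum A h.
Proof.
move=> h0 sh; rewrite (_ : h = fun s => h s - 0); last first.
  by apply/funext => s; rewrite subr0.
have s0 : summable A (EFin \o (fun=> 0 : R)).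
  by apply: (@summable_le A (fun=> 0) h) => // s; rewrite normr0.
rewrite [LHS](atomic_sum_diff (q := fun=> 0))//.
rewrite /pos_sum [X in _ - fine X]esum1//= subr0.
by under [in RHS]eq_fun do rewrite subr0.
Qed.

Lemma atomic_sum0 A : atomic_sum A (fun=> 0) = 0 :> R.
Proof.
rewrite atomic_sum_ge0E//; first by rewrite /pos_sum esum1.
by rewrite /summable esum1//= => s _; rewrite normr0.
Qed.

Lemma atomic_sumD A h1 h2 : summable A (EFin \o h1) -> summable A (EFin \o h2) ->
  atomic_sum A (fun s => h1 s + h2 s) = atomic_sum A h1 + atomic_sum A h2.
Proof.
move=> s1 s2; rewrite (atomic_sum_posneg s1) (atomic_sum_posneg s2).
have -> : (fun s => h1 s + h2 s) =
    (fun s => (pos h1 s + pos h2 s) - (neg h1 s + neg h2 s)).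
  apply/funext => s; rewrite {1}(posneg h1) {1}(posneg h2).
  by rewrite opprD addrACA.
rewrite [LHS](@atomic_sum_diff _ (fun s => pos h1 s + pos h2 s)
                            (fun s => neg h1 s + neg h2 s)).
- rewrite !pos_sumD//; try exact: pos_summable; try exact: neg_summable.
  by rewrite opprD addrACA.
- by move=> s; rewrite addr_ge0.
- by move=> s; rewrite addr_ge0.
- by apply: summable_add; exact: pos_summable.
- by apply: summable_add; exact: neg_summable.
Qed.

Lemma atomic_sumN A h : summable A (EFin \o h) ->
  atomic_sum A (fun s => - h s) = - atomic_sum A h.
Proof.
move=> sh; rewrite (atomic_sum_posneg sh) opprB.
rewrite -atomic_sum_diff//; [|exact: neg_summable|exact: pos_summable].
by congr atomic_sum; apply/funext => s; rewrite {1}(posneg h) opprB.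
Qed.

Lemma atomic_sumZ A c h : summable A (EFin \o h) ->
  atomic_sum A (fun s => c * h s) = c * atomic_sum A h.
Proof.
have pZ d : 0 <= d -> summable A (EFin \o h) ->
    atomic_sum A (fun s => d * h s) = d * atomic_sum A h.
  move=> d0 sh; rewrite (atomic_sum_posneg sh) mulrBr.
  have sp := pos_summable sh; have sn := neg_summable sh.
  rewrite -!pos_sumZ// -atomic_sum_diff//.
  - congr atomic_sum; apply/funext => s.
    by rewrite {1}(posneg h) mulrBr.
  - by move=> s; rewrite mulr_ge0.
  - by move=> s; rewrite mulr_ge0.
  - exact: summable_scale.
  - exact: summable_scale.
move=> sh; case: (leP 0 c) => [c0|c0]; first exact: pZ.
rewrite -[c]opprK mulNr -pZ ?oppr_ge0 ?(ltW c0)//.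
rewrite -atomic_sumN; last exact: summable_scale.
by congr atomic_sum; apply/funext => s; rewrite mulNr.
Qed.

Lemma atomic_sum_ge0 A h : (forall s, A s -> 0 <= h s) ->
  0 <= atomic_sum A h.
Proof.
move=> h0; rewrite /atomic_sum [X in (_ - X)%E]esum1 ?sube0.
  by rewrite fine_ge0// esum_ge0.
by move=> s As; rewrite funenegE/=; apply/max_idPr; rewrite lee_fin oppr_le0 h0.
Qed.

Lemma le_atomic_sum A h1 h2 : (forall s, A s -> h1 s <= h2 s) ->
  summable A (EFin \o h1) -> summable A (EFin \o h2) ->
  atomic_sum A h1 <= atomic_sum A h2.
Proof.
move=> h12 s1 s2; rewrite -subr_ge0 -atomic_sumN// -atomic_sumD//.
  by apply: atomic_sum_ge0 => s As; rewrite subr_ge0 h12.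
by apply: summable_le s1 => s; rewrite normrN.
Qed.

Lemma atomic_sum_disjoint A B h : [disjoint A & B] ->
  summable (A `|` B) (EFin \o h) ->
  atomic_sum (A `|` B) h = atomic_sum A h + atomic_sum B h.
Proof.
move=> AB sh.
have sA : summable A (EFin \o h).
  by apply: summable_subset sh; exact: subsetUl.
have sB : summable B (EFin \o h).
  by apply: summable_subset sh; exact: subsetUr.
rewrite !atomic_sum_posneg// !pos_sum_disjoint//.
- by rewrite opprD addrACA.
- exact: neg_summable.
- exact: pos_summable.
Qed.

Lemma summable_sum (K : Type) (r : seq K) A (h : K -> R -> R) :
  (forall k, summable A (EFin \o h k)) ->
  summable A (EFin \o (fun s => \sum_(k <- r) h k s)).
Proof.
move=> sh; elim: r => [|k r IH].
  by rewrite /summable esum1//= => s _; rewrite big_nil normr0.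
apply: (@summable_le A _ (fun s => h k s + \sum_(k <- r) h k s)).
  by move=> s; rewrite big_cons.
exact: summable_add.
Qed.

Lemma atomic_sum_sum (K : Type) (r : seq K) A (h : K -> R -> R) :
  (forall k, summable A (EFin \o h k)) ->
  atomic_sum A (fun s => \sum_(k <- r) h k s) =
  \sum_(k <- r) atomic_sum A (h k).
Proof.
move=> sh; elim: r => [|k r IH].
  by rewrite big_nil; under eq_fun do rewrite big_nil; rewrite atomic_sum0.
rewrite big_cons -IH; under eq_fun do rewrite big_cons.
by rewrite atomic_sumD//; exact: summable_sum.
Qed.

End AtomicSums.

(** * Differential measures without singular part *)

Section Differentials.
Context {R : realType}.
Implicit Types (a b t : R) (phi psi Y : R -> R).
Local Notation mu := (@lebesgue_measure R).

Lemma integrable_sumR (K : Type) (r : seq K) (D : set R) (h : K -> R -> R) :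
  measurable D -> (forall k, mu.-integrable D (EFin \o h k)) ->
  mu.-integrable D (EFin \o (fun s => \sum_(k <- r) h k s)).
Proof.
move=> mD ih.
have -> : EFin \o (fun s => \sum_(k <- r) h k s) =
    (fun s => \sum_(k <- r) (EFin \o h k) s)%E.
  by apply/funext => s /=; rewrite sumEFin.
exact: integrable_sum.
Qed.

Lemma integrable_scaleR (D : set R) c (h : R -> R) : measurable D ->
  mu.-integrable D (EFin \o h) -> mu.-integrable D (EFin \o (fun s => c * h s)).
Proof.
move=> mD ih.
have -> : EFin \o (fun s => c * h s) = (fun s => c%:E * (EFin \o h) s)%E.
  by apply/funext => s /=; rewrite EFinM.
exact: integrableZl.
Qed.

Lemma Rintegral_sum (K : Type) (r : seq K) (D : set R) (h : K -> R -> R) :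
  measurable D -> (forall k, mu.-integrable D (EFin \o h k)) ->
  \int[mu]_(s in D) (\sum_(k <- r) h k s) =
  \sum_(k <- r) \int[mu]_(s in D) h k s.
Proof.
move=> mD ih; elim: r => [|k r IH].
  rewrite big_nil; under eq_Rintegral do rewrite big_nil.
  by rewrite Rintegral_cst// mul0r.
rewrite big_cons -IH; under eq_Rintegral do rewrite big_cons.
by rewrite RintegralD//; exact: integrable_sumR.
Qed.

(** Such a function coincides almost everywhere with its absolute value. *)
Lemma ae_Rintegral_ge0 (D : set R) (h : R -> R) : measurable D ->
  mu.-integrable D (EFin \o h) -> {ae mu, forall s, D s -> 0 <= h s} ->
  0 <= \int[mu]_(s in D) h s.
Proof.
move=> mD ih h0.
suff -> : \int[mu]_(s in D) h s = \int[mu]_(s in D) `|h s|.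
  by apply: Rintegral_ge0 => s _.
congr fine; apply: ae_eq_integral => //.
- exact: measurable_int ih.
- exact: measurable_int (integrable_norm ih).
- apply: filterS h0; first exact: (ae_filter_ringOfSetsType mu).
  by move=> s h0 Ds; rewrite /= ger0_norm// h0.
Qed.

Lemma loc_integrable_sub phi a b (D : set R) : loc_integrable phi ->
  0 <= a <= b -> measurable D -> D `<=` `[a, b] ->
  mu.-integrable D (EFin \o phi).
Proof.
move=> iphi /andP[a0 ab] mD Dab.
apply: integrableS (iphi b (le_trans a0 ab)) => //.
apply: subset_trans Dab _ => s /=; rewrite !in_itv/= => /andP[as_ ->].
by rewrite (le_trans a0 as_).
Qed.

Lemma loc_summable_sub psi a b (D : set R) : loc_summable psi ->
  0 <= a <= b -> D `<=` `[a, b] -> summable D (EFin \o psi).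
Proof.
move=> ipsi /andP[a0 ab] Dab.
apply: summable_subset (ipsi b (le_trans a0 ab)).
apply: subset_trans Dab _ => s /=; rewrite !in_itv/= => /andP[as_ ->].
by rewrite (le_trans a0 as_).
Qed.

Lemma itv_split_ends a b : a < b ->
  `[a, b]%classic = `[a, a] `|` (`]a, b[ `|` `[b, b]) :> set R.
Proof.
move=> ab; apply/seteqP; split => s /=; rewrite !in_itv/=.
  move=> /andP[as_ sb]; have [->|na] := eqVneq s a; first by left; rewrite lexx.
  right; have [->|nb] := eqVneq s b; first by right; rewrite lexx.
  by left; rewrite !lt_def na as_ sb eq_sym nb.
case=> [/andP[as_ sa]|[/andP[as_ sb]|/andP[bs sb]]].
- by rewrite as_ (le_trans sa)// ltW.
- by rewrite (ltW as_) (ltW sb).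
- by rewrite sb andbT (le_trans _ bs)// ltW.
Qed.

Lemma itv_disjoint_ends a b : a < b ->
  [disjoint `[a, a]%classic & `]a, b[%classic `|` `[b, b]%classic] /\
  [disjoint `]a, b[%classic & `[b, b]%classic].
Proof.
move=> ab; split; apply/disj_setPS => s /=; rewrite !in_itv/=.
  case=> /andP[as_ sa] [/andP[]|/andP[bs _]].
    by move=> /(le_lt_trans sa); rewrite ltxx.
  by move: (lt_le_trans ab (le_trans bs sa)); rewrite ltxx.
by case=> /andP[_ sb] /andP[/(lt_le_trans sb)]; rewrite ltxx.
Qed.

Lemma atomic_sum_ends psi a b : loc_summable psi -> 0 <= a < b ->
  atomic_sum `[a, b] psi =
  atomic_sum `[a, a] psi + (atomic_sum `]a, b[ psi + atomic_sum `[b, b] psi).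
Proof.
move=> spsi /andP[a0 ab].
have [d1 d2] := itv_disjoint_ends ab.
have s1 : summable `[a, b] (EFin \o psi).
  by apply: (loc_summable_sub spsi (a := a) (b := b)); rewrite ?a0 ?ltW.
have := s1; rewrite {1}(itv_split_ends ab) => s2.
have s3 : summable (`]a, b[%classic `|` `[b, b]%classic) (EFin \o psi).
  by apply: summable_subset s2; exact: subsetUr.
by rewrite {1}(itv_split_ends ab) !atomic_sum_disjoint.
Qed.

(** The values on compact intervals of the measure [phi dt + psi deta], for a
    function of bounded variation known through its right and left limits. *)
Definition differential Yp Ym phi psi : Prop :=
  [/\ loc_integrable phi, loc_summable psi &
      forall a b, 0 <= a -> a <= b ->
        Yp b - Ym a = \int[mu]_(s in `[a, b]) phi s + atomic_sum `[a, b] psi].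

Lemma Rintegral_itv_oo phi a b : loc_integrable phi -> 0 <= a < b ->
  \int[mu]_(s in `]a, b[) phi s = \int[mu]_(s in `[a, b]) phi s.
Proof.
move=> iphi /andP[a0 ab].
have ii (D : set R) : measurable D -> D `<=` `[a, b] ->
    mu.-integrable D (EFin \o phi).
  by apply: loc_integrable_sub; rewrite // a0 ltW.
rewrite Rintegral_itv_bndo_bndc; last by apply: ii => //; exact: subset_itv_oo_cc.
by rewrite Rintegral_itv_obnd_cbnd//; apply: ii => //; exact: subset_itv_oc_cc.
Qed.

Lemma Rintegral_itv_split phi a b : loc_integrable phi -> 0 <= a < b ->
  \int[mu]_(s in `[0, b]) phi s - \int[mu]_(s in `[0, a]) phi s =
  \int[mu]_(s in `]a, b[) phi s.
Proof.
move=> iphi /andP[a0 ab].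
have b0 : 0 <= b by rewrite (le_trans a0)// ltW.
rewrite Rintegral_itvB//; first last.
- by rewrite bnd_simp ltW.
- exact: iphi.
rewrite Rintegral_itv_bndo_bndc//.
apply: (loc_integrable_sub iphi (a := a) (b := b)) => //.
  by rewrite a0 ltW.
exact: subset_itv_oo_cc.
Qed.

(** Open intervals leave out the jumps at both ends: a function with one-sided
    limits is nearly constant on a short interval of this kind, however close
    it is to a large jump. *)
Lemma differential_open Yp Ym phi psi a b : differential Yp Ym phi psi ->
  0 <= a < b ->
  Ym b - Yp a = \int[mu]_(s in `]a, b[) phi s + atomic_sum `]a, b[ psi.
Proof.
move=> [iphi spsi dY] /andP[a0 ab].
have b0 : 0 <= b by rewrite (le_trans a0)// ltW.
have := dY _ _ a0 (ltW ab); rewrite atomic_sum_ends ?a0//.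
have := dY _ _ a0 (lexx a); have := dY _ _ b0 (lexx b).
have i1 c : \int[mu]_(s in `[c, c]) phi s = 0 by rewrite set_itv1 Rintegral_set1.
by rewrite !i1 Rintegral_itv_oo ?a0//; lra.
Qed.

(** The mass on [[0, t]] of the total variation of [phi dt + psi deta]. *)
Definition variation phi psi t : R :=
  \int[mu]_(s in `[0, t]) `|phi s| + atomic_sum `[0, t] (fun s => `|psi s|).

Lemma loc_integrable_norm phi : loc_integrable phi ->
  loc_integrable (fun s => `|phi s|).
Proof. by move=> iphi T T0; exact: integrable_norm (iphi T T0). Qed.

Lemma loc_summable_norm psi : loc_summable psi ->
  loc_summable (fun s => `|psi s|).
Proof.
by move=> spsi T T0; apply: summable_le (spsi T T0) => s; rewrite normr_id.
Qed.

Lemma variation_open phi psi a b : loc_integrable phi -> loc_summable psi ->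
  0 <= a < b ->
  \int[mu]_(s in `]a, b[) `|phi s| + atomic_sum `]a, b[ (fun s => `|psi s|)
    <= variation phi psi b - variation phi psi a.
Proof.
move=> /loc_integrable_norm iphi /loc_summable_norm spsi aab.
have /andP[a0 ab] := aab.
rewrite -(Rintegral_itv_split iphi)// /variation.
suff : atomic_sum `[0, a] (fun s => `|psi s|)
       + atomic_sum `]a, b[ (fun s => `|psi s|)
       <= atomic_sum `[0, b] (fun s => `|psi s|) by lra.
have b0 : 0 <= b by rewrite (le_trans a0)// ltW.
have dis : [disjoint `[0, a]%classic & `]a, b]%classic].
  apply/disj_setPS => s /=; rewrite !in_itv/= => -[/andP[_ sa] /andP[as_ _]].
  by move: (le_lt_trans sa as_); rewrite ltxx.
have -> : `[0, b]%classic = `[0, a] `|` `]a, b].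
  by rewrite -itv_bndbnd_setU ?bnd_simp// ltW.
rewrite atomic_sum_disjoint//; last first.
  by rewrite -itv_bndbnd_setU ?bnd_simp ?(ltW ab)//; exact: spsi.
rewrite lerD2l.
have -> : `]a, b]%classic = `]a, b[ `|` `[b, b].
  by rewrite -itv_bndbnd_setU ?bnd_simp// ltW.
have [_ dis2] := itv_disjoint_ends ab.
rewrite atomic_sum_disjoint//.
  by rewrite lerDl atomic_sum_ge0.
rewrite -itv_bndbnd_setU ?bnd_simp//.
apply: (loc_summable_sub spsi (a := a) (b := b)); first by rewrite a0 ltW.
exact: subset_itv_oc_cc.
Qed.

End Differentials.

(** * From local to global estimates *)

Section LocalToGlobal.
Context {R : realType}.
Implicit Types (a b s t : R).
Local Notation mu := (@lebesgue_measure R).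

Lemma near_right_forall t (Q : set R) : (\forall s \near t^'+, Q s) ->
  \forall s \near t^'+, forall r, t < r < s -> Q r.
Proof.
move=> [d /= d0 tQ]; exists d => //= s td ts r /andP[tr rs].
apply: tQ => //=; apply: le_lt_trans td.
by rewrite !ltr0_norm ?subr_lt0//; lra.
Qed.

Lemma near_left_forall t (Q : set R) : (\forall s \near t^'-, Q s) ->
  \forall s \near t^'-, forall r, s < r < t -> Q r.
Proof.
move=> [d /= d0 tQ]; exists d => //= s td ts r /andP[sr rt].
apply: tQ => //=; apply: le_lt_trans td.
by rewrite !gtr0_norm ?subr_gt0//; lra.
Qed.

(** The supremum of the times that can be reached from [a] can itself be
    reached, by the estimate on its left, and passed, by the one on
    its right. *)
Lemma local_to_global (P : R -> R -> Prop) a b : a <= b ->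
  (forall t, P t t) -> (forall r s t, P r s -> P s t -> P r t) ->
  (forall t, a <= t < b -> \forall s \near t^'+, P t s) ->
  (forall t, a < t <= b -> \forall s \near t^'-, P s t) ->
  P a b.
Proof.
move=> ab Prefl Ptrans Pright Pleft.
pose S := [set t | a <= t <= b /\ P a t].
have Sa : S a by split; rewrite ?lexx ?ab.
have Sub : ubound S b by move=> t [/andP[]].
have hS : has_sup S by split; [exists a|exists b].
pose c := sup S.
have ac : a <= c by apply: sup_upper_bound.
have cb : c <= b by apply: sup_le_ub => //; exists a.
have Pac : P a c.
  move: ac; rewrite le_eqVlt => /predU1P[<-//|ac].
  have [d /= d0 dP] := Pleft c (introT andP (conj ac cb)).
  have [t St tc] := sup_adherent d0 hS.
  have := sup_upper_bound hS St; rewrite -/c le_eqVlt => /predU1P[<-|ltc].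
    by case: St.
  apply: Ptrans (proj2 St) _; apply: dP => //=.
  by rewrite gtr0_norm ?subr_gt0// ltrBlDr -ltrBlDl.
move: cb; rewrite le_eqVlt => /predU1P[<-//|cb].
have := Pright c (introT andP (conj ac cb)) => -[d /= d0 dP].
pose t := c + Num.min (d / 2) (b - c).
have m0 : 0 < Num.min (d / 2) (b - c).
  by rewrite lt_min subr_gt0 cb andbT divr_gt0.
have ct : c < t by rewrite ltrDl.
have tb : t <= b.
  by rewrite /t -lerBrDl ge_min lexx orbT.
have St : S t.
  split; first by rewrite tb (le_trans ac)// ltW.
  apply: Ptrans Pac _; apply: dP => //=.
  rewrite ltr0_norm ?subr_lt0// opprB /t addrAC subrr add0r.
  by rewrite gt_min ltr_pdivrMr// ltr_pMr// ltr1n.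
by have := sup_upper_bound hS St; rewrite leNgt ct.
Qed.

Section Integrators.
Context (K : finType) (Yp Ym phi psi : K -> R -> R).
Hypothesis dY : forall k, differential (Yp k) (Ym k) (phi k) (psi k).

Definition total_variation t : R := \sum_k variation (phi k) (psi k) t.

Lemma sum_perturbation (c c' y : K -> R) e : (forall k, `|c' k - c k| <= e) ->
  \sum_k c' k * y k <= \sum_k c k * y k + e * \sum_k `|y k|.
Proof.
move=> cc'; rewrite mulr_sumr -big_split /=; apply: ler_sum => k _.
rewrite -lerBlDl -mulrBl; apply: le_trans (ler_norm _) _.
by rewrite normrM ler_wpM2r.
Qed.

(** The coefficients [c'] cost [e] times the variation when they are
    replaced by the constants [c], which can be moved under the integrals
    and the sums; there the density and the atoms cost [e] times the variation
    once more. *)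
Lemma sum_increment_le (c c' : K -> R) e a b : 0 <= a < b -> 0 <= e ->
  {ae mu, forall s, `]a, b[%classic s ->
    \sum_k c k * phi k s <= e * \sum_k `|phi k s|} ->
  (forall s, `]a, b[%classic s ->
    \sum_k c k * psi k s <= e * \sum_k `|psi k s|) ->
  (forall k, `|c' k - c k| <= e) ->
  \sum_k c' k * (Ym k b - Yp k a)
    <= 2 * e * (total_variation b - total_variation a).
Proof.
move=> aab e0 cphi cpsi cc'.
have /andP[a0 ab] := aab.
have aabW : 0 <= a <= b by rewrite a0 ltW.
pose D : set R := `]a, b[%classic.
have mD : measurable D by exact: measurable_itv.
have Dab : D `<=` `[a, b] by exact: subset_itv_oo_cc.
have iphi k : mu.-integrable D (EFin \o phi k).
  have [ip _ _] := dY k.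
  exact: (loc_integrable_sub ip aabW mD Dab).
have spsi k : summable D (EFin \o psi k).
  by have [_ sp _] := dY k; exact: (loc_summable_sub sp aabW Dab).
pose I k := \int[mu]_(s in D) phi k s.
pose J k := atomic_sum D (psi k).
pose NI k := \int[mu]_(s in D) `|phi k s|.
pose NJ k := atomic_sum D (fun s => `|psi k s|).
have inphi k : mu.-integrable D (EFin \o (fun s => `|phi k s|)).
  exact: integrable_norm (iphi k).
have snpsi k : summable D (EFin \o (fun s => `|psi k s|)).
  by apply: summable_le (spsi k) => s; rewrite normr_id.
have izphi k : mu.-integrable D (EFin \o (fun s => c k * phi k s)).
  exact: integrable_scaleR.
have eI k : Ym k b - Yp k a = I k + J k by exact: (differential_open (dY k)).
have leI k : `|I k| <= NI k by exact: le_normr_Rintegral.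
have leJ k : `|J k| <= NJ k.
  rewrite ler_norml; apply/andP; split.
    rewrite /NJ -atomic_sumN//; apply: le_atomic_sum => //.
      by move=> s _; rewrite lerNl -normrN ler_norm.
    by apply: summable_le (snpsi k) => s; rewrite normrN.
  by apply: le_atomic_sum => // s _; exact: ler_norm.
have leV : \sum_k (NI k + NJ k) <= total_variation b - total_variation a.
  rewrite /total_variation -sumrB; apply: ler_sum => k _.
  by have [ip sp _] := dY k; exact: variation_open.
have leIc : \sum_k c k * I k <= e * \sum_k NI k.
  have -> : \sum_k c k * I k = \int[mu]_(s in D) (\sum_k c k * phi k s).
    by rewrite Rintegral_sum//; apply: eq_bigr => k _; rewrite RintegralZl.
  have -> : e * \sum_k NI k = \int[mu]_(s in D) (e * \sum_k `|phi k s|).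
    by rewrite RintegralZl//; [rewrite Rintegral_sum|exact: integrable_sumR].
  rewrite -subr_ge0 -RintegralB//; last 2 first.
  - by apply: integrable_scaleR => //; exact: integrable_sumR.
  - exact: integrable_sumR.
  apply: ae_Rintegral_ge0 => //.
    apply: (@integrableB _ _ _ mu D _ (EFin \o _) (EFin \o _)) => //.
    - by apply: integrable_scaleR => //; exact: integrable_sumR.
    - exact: integrable_sumR.
  apply: filterS cphi; first exact: (ae_filter_ringOfSetsType mu).
  by move=> s + Ds => /(_ Ds); rewrite subr_ge0.
have leJc : \sum_k c k * J k <= e * \sum_k NJ k.
  have -> : \sum_k c k * J k = atomic_sum D (fun s => \sum_k c k * psi k s).
    rewrite atomic_sum_sum.
      by apply: eq_bigr => k _; rewrite atomic_sumZ.
    by move=> k; exact: summable_scale.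
  have -> : e * \sum_k NJ k = atomic_sum D (fun s => e * \sum_k `|psi k s|).
    by rewrite atomic_sumZ ?atomic_sum_sum//; exact: summable_sum.
  apply: le_atomic_sum => //.
    by apply: summable_sum => k; exact: summable_scale.
  by apply: summable_scale; exact: summable_sum.
apply: le_trans (sum_perturbation (c := c) _ cc') _.
have -> : \sum_k c k * (Ym k b - Yp k a) = \sum_k c k * I k + \sum_k c k * J k.
  by rewrite -big_split; apply: eq_bigr => k _; rewrite eI mulrDr.
have leY : \sum_k `|Ym k b - Yp k a| <= \sum_k NI k + \sum_k NJ k.
  rewrite -big_split; apply: ler_sum => k _; rewrite eI /=.
  by rewrite (le_trans (ler_normD _ _))// lerD.
have := ler_wpM2l e0 leV; have := ler_wpM2l e0 leY.
rewrite big_split /=; lra.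
Qed.

(** At a fixed time, the increments of [F] are bounded by combinations of
    the increments of the integrators.  When the coefficients
    converge to the same limit as coefficients for which both the density and
    the atoms of the combination are nonpositive, the increments of [F] are
    negligible with respect to the total variation. *)
Section LocalEstimate.
Context (A : set R) (F : R -> R -> R) (ci cf cj : R -> K -> R) (c : K -> R).
Hypothesis flow_le0 : {ae mu, forall s, 0 <= s -> A s ->
  \sum_k cf s k * phi k s <= 0}.
Hypothesis jump_le0 : forall s, 0 <= s -> A s -> \sum_k cj s k * psi k s <= 0.

Let interval_estimate e a b s : 0 < e -> 0 <= a < b ->
  (forall k, `|c k - ci s k| <= e) ->
  (forall r, a < r < b -> A r) ->
  (forall r, a < r < b -> forall k, `|c k - cf r k| <= e) ->
  (forall r, a < r < b -> forall k, `|c k - cj r k| <= e) ->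
  \sum_k ci s k * (Ym k b - Yp k a)
    <= 2 * e * (total_variation b - total_variation a).
Proof.
move=> e0 aab cci rA ccf ccj; have /andP[a0 ab] := aab.
apply: (sum_increment_le (c := c)) => //; first exact: ltW.
- apply: filterS flow_le0; first exact: (ae_filter_ringOfSetsType mu).
  move=> r + /=; rewrite in_itv /= => rflow rab.
  have /andP[ar _] := rab.
  have := rflow (le_trans a0 (ltW ar)) (rA _ rab).
  by have := sum_perturbation (phi ^~ r) (ccf _ rab); lra.
- move=> r /=; rewrite in_itv /= => rab; have /andP[ar _] := rab.
  have := jump_le0 (le_trans a0 (ltW ar)) (rA _ rab).
  by have := sum_perturbation (psi ^~ r) (ccj _ rab); lra.
- by move=> k; rewrite distrC.
Qed.

Let near_forall_dist (G : set_system R) (h : R -> K -> R) e : Filter G -> 0 < e ->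
  (forall k, h s k @[s --> G] --> c k) ->
  \forall s \near G, forall k, `|c k - h s k| <= e.
Proof.
move=> FG e0 hc; apply: filter_forall => k.
by have /cvgrPdist_le := hc k; apply.
Qed.

Lemma right_estimate (t : R) : 0 <= t ->
  (\forall s \near t^'+, A s) ->
  (forall k, ci s k @[s --> t^'+] --> c k) ->
  (forall k, cf s k @[s --> t^'+] --> c k) ->
  (forall k, cj s k @[s --> t^'+] --> c k) ->
  (\forall s \near t^'+, F t s <= \sum_k ci s k * (Ym k s - Yp k t)) ->
  forall e, 0 < e -> \forall s \near t^'+,
    F t s <= e * (total_variation s - total_variation t).
Proof.
move=> t0 nA hi hf hj nF e e0.
have e20 : 0 < e / 2 by rewrite divr_gt0.
have ni := near_forall_dist _ e20 hi.
have nf := near_right_forall (near_forall_dist _ e20 hf).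
have nj := near_right_forall (near_forall_dist _ e20 hj).
have nA' := near_right_forall nA.
near=> s; apply: (@le_trans _ _ (\sum_k ci s k * (Ym k s - Yp k t))).
  by near: s.
rewrite [X in X * _](_ : e = 2 * (e / 2)); last by field.
apply: interval_estimate => //.
- by apply/andP; split => //; near: s; exact: nbhs_right_gt.
- by near: s; exact: ni.
- by near: s; exact: nA'.
- by near: s; exact: nf.
- by near: s; exact: nj.
Unshelve. all: by end_near. Qed.

Lemma left_estimate (t : R) : 0 < t ->
  (\forall s \near t^'-, A s) ->
  (forall k, ci s k @[s --> t^'-] --> c k) ->
  (forall k, cf s k @[s --> t^'-] --> c k) ->
  (forall k, cj s k @[s --> t^'-] --> c k) ->
  (\forall s \near t^'-, F s t <= \sum_k ci s k * (Ym k t - Yp k s)) ->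
  forall e, 0 < e -> \forall s \near t^'-,
    F s t <= e * (total_variation t - total_variation s).
Proof.
move=> t0 nA hi hf hj nF e e0.
have e20 : 0 < e / 2 by rewrite divr_gt0.
have ni := near_forall_dist _ e20 hi.
have nf := near_left_forall (near_forall_dist _ e20 hf).
have nj := near_left_forall (near_forall_dist _ e20 hj).
have nA' := near_left_forall nA.
near=> s; apply: (@le_trans _ _ (\sum_k ci s k * (Ym k t - Yp k s))).
  by near: s.
rewrite [X in X * _](_ : e = 2 * (e / 2)); last by field.
apply: interval_estimate => //.
- apply/andP; split; near: s; first by apply: filterS (nbhs_left_gt t0) => s /ltW.
  exact: nbhs_left_lt.
- by near: s; exact: ni.
- by near: s; exact: nA'.
- by near: s; exact: nf.
- by near: s; exact: nj.
Unshelve. all: by end_near. Qed.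

End LocalEstimate.
End Integrators.
End LocalToGlobal.

(** * Euclidean geometry and convexity *)

Section Euclid.
Context {R : realType} {n : nat}.
Implicit Types (u v x y z : 'rV[R]_n) (f : 'rV[R]_n -> R).

Lemma dotrC u v : dotr u v = dotr v u.
Proof. by apply: eq_bigr => j _; rewrite mulrC. Qed.

Lemma dotrDl u v x : dotr (u + v) x = dotr u x + dotr v x.
Proof. by rewrite -big_split; apply: eq_bigr => j _; rewrite mxE mulrDl. Qed.

Lemma dotrZl (c : R) u x : dotr (c *: u) x = c * dotr u x.
Proof. by rewrite mulr_sumr; apply: eq_bigr => j _; rewrite mxE mulrA. Qed.

Lemma dotrNl u x : dotr (- u) x = - dotr u x.
Proof. by rewrite -scaleN1r dotrZl mulN1r. Qed.

Lemma dotrDr u v x : dotr x (u + v) = dotr x u + dotr x v.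
Proof. by rewrite dotrC dotrDl ![dotr _ x]dotrC. Qed.

Lemma dotrZr (c : R) u x : dotr x (c *: u) = c * dotr x u.
Proof. by rewrite dotrC dotrZl dotrC. Qed.

Lemma dotrNr u x : dotr x (- u) = - dotr x u.
Proof. by rewrite dotrC dotrNl dotrC. Qed.

Definition dotrE := (dotrDl, dotrDr, dotrNl, dotrNr, dotrZl, dotrZr).

Lemma dotr_suml (K : Type) (r : seq K) (P : pred K) (c : K -> R)
    (v : K -> 'rV[R]_n) x :
  dotr (\sum_(k <- r | P k) c k *: v k) x =
  \sum_(k <- r | P k) c k * dotr (v k) x.
Proof.
elim/big_rec2: _ => [|k _ w _ <-]; last by rewrite dotrDl dotrZl.
by rewrite -(scale0r 0) dotrZl mul0r.
Qed.

Lemma dotrr_ge0 v : 0 <= dotr v v.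
Proof. by apply: sumr_ge0 => j _; rewrite -expr2 sqr_ge0. Qed.

Lemma enorm_sqr v : enorm v ^+ 2 = dotr v v.
Proof. by rewrite sqr_sqrtr// dotrr_ge0. Qed.

Lemma norm_coord_le_enorm v j : `|v 0 j| <= enorm v.
Proof.
rewrite -(ler_pXn2r (n := 2))// ?nnegrE ?sqrtr_ge0// enorm_sqr real_normK ?num_real//.
by rewrite /dotr (bigD1 j)//= expr2 lerDl sumr_ge0// => k _; rewrite -expr2 sqr_ge0.
Qed.

Lemma derive_dotr f x v : differentiable f x -> 'D_v f x = dotr (grad f x) v.
Proof.
move=> df; rewrite deriveE// [in LHS](row_sum_delta v) linear_sum.
apply: eq_bigr => j _; rewrite linearZ mxE deriveE//.
by rewrite mulrC.
Qed.

(** Strong convexity bounds the difference quotients of [f] at [x] in the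
    direction of [y]; the step tends to zero. *)
Lemma strongly_convex_grad mu f x y : strongly_convex mu f ->
  differentiable f x ->
  f x + dotr (grad f x) (y - x) + mu / 2 * dotr (y - x) (y - x) <= f y.
Proof.
move=> cf df.
suff : 'D_(y - x) f x <= f y - f x - mu / 2 * dotr (y - x) (y - x).
  by rewrite derive_dotr//; lra.
have /cvg_dnbhs_at_right cD := diff_derivable (v := y - x) df.
pose q (h : R) := f y - f x - mu / 2 * (1 - h) * dotr (y - x) (y - x).
have cq : q h @[h --> 0^'+] --> q 0.
  apply: cvg_at_right_filter; apply: cvgB; first exact: cvg_cst.
  apply: cvgM; last exact: cvg_cst.
  apply: cvgM; first exact: cvg_cst.
  by apply: cvgB; [exact: cvg_cst|exact: cvg_id].
have -> : f y - f x - mu / 2 * dotr (y - x) (y - x) = q 0.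
  by rewrite /q subr0 mulr1.
apply: ler_cvg_to cD cq _; near=> h.
have h0 : 0 < h by near: h; exact: nbhs_right_gt.
have h1 : h < 1 by near: h; apply: nbhs_right_lt.
have hx : h *: (y - x) + x = h *: y + (1 - h) *: x.
  by rewrite scalerBr scalerBl scale1r -addrA [- _ + _]addrC.
rewrite /= hx /GRing.scale /= mulrC ler_pdivrMr//.
have := cf h y x; rewrite enorm_sqr (ltW h0) (ltW h1) => /(_ isT).
by rewrite /q; lra.
Unshelve. all: by end_near. Qed.

Lemma convex_strongly_convex f : convex_fun f -> strongly_convex 0 f.
Proof.
move=> cf t x y t01; have /andP[t0 t1] := t01.
rewrite !mul0r subr0.
have := cf (Itv01 t0 t1) x y; rewrite !inE => /(_ I I).
by rewrite convRE.
Qed.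

Lemma convex_grad f x y : convex_fun f -> differentiable f x ->
  f x + dotr (grad f x) (y - x) <= f y.
Proof.
move=> /convex_strongly_convex cf df.
by have := strongly_convex_grad y cf df; rewrite !mul0r addr0.
Qed.

Lemma gradN f x : differentiable f x -> grad (fun y => - f y) x = - grad f x.
Proof.
move=> df; apply/rowP => j; rewrite !mxE.
by rewrite (deriveN (diff_derivable df)).
Qed.

Lemma concave_grad f x y : concave_fun f -> differentiable f x ->
  f y <= f x + dotr (grad f x) (y - x).
Proof.
move=> cf df; have := convex_grad y cf (differentiableN df).
by rewrite gradN// dotrNl; lra.
Qed.

Lemma concave_grad_le f x y : concave_fun f -> differentiable f x ->
  dotr (grad f x) (x - y) <= f x - f y.
Proof.
move=> cf df; have := concave_grad y cf df.
by rewrite -[y - x]opprB dotrNr; lra.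
Qed.

(** Comparing the two gradient inequalities between two points at unit
    distance; in dimension zero there are no such points. *)
Lemma smooth_strongly_convex_le1 mu f : (0 < n)%N -> smooth 1 f ->
  strongly_convex mu f -> mu <= 1.
Proof.
move=> n0 [df lf] cf; pose j : 'I_n := Ordinal n0.
pose d : 'rV[R]_n := delta_mx 0 j.
have dd v : dotr v d = v 0 j.
  rewrite /dotr (bigD1 j)//= big1 ?addr0 ?mxE ?eqxx ?mulr1// => k kj.
  by rewrite mxE (negbTE kj) andbF mulr0.
have d1 : dotr d d = 1 by rewrite dd mxE !eqxx.
have := strongly_convex_grad d cf (df 0).
have := strongly_convex_grad 0 cf (df d).
have := lf d 0; have := norm_coord_le_enorm (grad f d - grad f 0) j.
rewrite subr0 sub0r [enorm d]/enorm !dotrE d1 sqrtr1 !dd.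
move: (grad f d) (grad f 0) => a b.
have := ler_norm ((a - b) 0 j); rewrite !mxE; lra.
Qed.

End Euclid.

(** * One-sided limits *)

Section Limits.
Context {R : realType}.
Implicit Types (s t r : R).

Lemma near_right_near t (Q : set R) : (\forall s \near t^'+, Q s) ->
  \forall s \near t^'+, \forall r \near s, Q r.
Proof.
move=> /near_right_forall tQ.
have [b [tb Qb]] : exists b, t < b /\ forall r, t < r < b -> Q r.
  by have [b [? ?]] := filter_ex (filterI (nbhs_right_gt t) tQ); exists b.
near=> s; near=> r; apply: Qb; apply/andP; split; near: r.
  by apply: lt_nbhsr; near: s; exact: nbhs_right_gt.
by apply: lt_nbhsl; near: s; exact: nbhs_right_lt.
Unshelve. all: by end_near. Qed.

Lemma near_left_near t (Q : set R) : (\forall s \near t^'-, Q s) ->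
  \forall s \near t^'-, \forall r \near s, Q r.
Proof.
move=> /near_left_forall tQ.
have [b [tb Qb]] : exists b, b < t /\ forall r, b < r < t -> Q r.
  by have [b [? ?]] := filter_ex (filterI (nbhs_left_lt t) tQ); exists b.
near=> s; near=> r; apply: Qb; apply/andP; split; near: r.
  by apply: lt_nbhsr; near: s; exact: nbhs_left_gt.
by apply: lt_nbhsl; near: s; exact: nbhs_left_lt.
Unshelve. all: by end_near. Qed.

(** [G] is meant to be a one-sided neighborhood of a time and [H s] a one-sided
    neighborhood of [s]. *)
Lemma cvg_one_sided_limits (V : normedModType R) (G : set_system R)
    (H : R -> set_system R) (u v : R -> V) (l : V) :
  ProperFilter G -> (forall s, ProperFilter (H s)) ->
  (forall Q : set R, (\forall s \near G, Q s) ->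
    \forall s \near G, \forall r \near s, Q r) ->
  (forall s, H s `=>` nbhs s) ->
  u r @[r --> G] --> l ->
  (\forall s \near G, u r @[r --> H s] --> v s) ->
  v s @[s --> G] --> l.
Proof.
move=> FG FH GG HG ul uv; apply/cvgrPdist_le => e e0.
have /cvgrPdist_le/(_ e e0)/GG := ul.
apply: filterS2 uv => s uvs sl.
have FHs := FH s.
apply: (cvgr_to_le (cvg_norm (cvgB (cvg_cst l) uvs))).
exact: HG sl.
Qed.

Lemma cvg_row (n : nat) (T : Type) (G : set_system T) (x : T -> 'rV[R]_n)
    (X : 'rV[R]_n) :
  Filter G -> (forall j, x s 0 j @[s --> G] --> X 0 j) -> x s @[s --> G] --> X.
Proof.
move=> FG xX A [P /= XP PA].
have : \forall s \near G, forall j, P 0 j (x s 0 j).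
  by apply: filter_forall => j; exact: (xX j _ (XP 0 j)).
by apply: filterS => s Ps; apply: PA => i j; rewrite ord1.
Qed.

Lemma cvg_coord (n : nat) (T : Type) (G : set_system T) (x : T -> 'rV[R]_n)
    (X : 'rV[R]_n) j :
  x s @[s --> G] --> X -> x s 0 j @[s --> G] --> X 0 j.
Proof.
move=> xX.
exact: (cvg_comp x (fun M : 'rV[R]_n => M 0 j) xX (@coord_continuous R 1 n 0 j X)).
Qed.

Lemma cvg_dotr (n : nat) (T : Type) (G : set_system T) (x y : T -> 'rV[R]_n)
    (X Y : 'rV[R]_n) :
  Filter G -> x s @[s --> G] --> X -> y s @[s --> G] --> Y ->
  dotr (x s) (y s) @[s --> G] --> dotr X Y.
Proof.
move=> FG xX yY; apply: cvg_big; first exact: add_continuous.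
by move=> j _; apply: cvgM; apply: cvg_coord.
Qed.

Lemma cvg_grad (n : nat) (L : R) (f : 'rV[R]_n -> R) (T : Type)
    (G : set_system T) (x : T -> 'rV[R]_n)
    (X : 'rV[R]_n) :
  Filter G -> smooth L f -> x s @[s --> G] --> X ->
  grad f (x s) @[s --> G] --> grad f X.
Proof.
move=> FG [_ lf] xX; apply: cvg_row => j; apply/cvgrPdist_le => e e0.
have e1 : 0 < e / (1 + `|L|) by rewrite divr_gt0// ltr_pwDl.
have : dotr (X - x s) (X - x s) @[s --> G] --> 0.
  rewrite -[0](_ : dotr (X - X) (X - X) = 0); last first.
    by rewrite subrr -(scale0r 0) dotrZl mul0r.
  by apply: cvg_dotr; apply: cvgB => //; exact: cvg_cst.
move=> /cvgrPdist_le/(_ _ (exprn_gt0 2 e1)); apply: filterS => s.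
rewrite sub0r normrN ger0_norm ?dotrr_ge0// -enorm_sqr.
rewrite ler_pXn2r// ?nnegrE ?sqrtr_ge0// => [|]; last exact: ltW.
rewrite ler_pdivlMr ?ltr_pwDl// => xXe.
have := norm_coord_le_enorm (grad f X - grad f (x s)) j; rewrite mxE [X in _ + X]mxE.
move=> /le_trans; apply; apply: le_trans (lf _ _) (le_trans _ xXe).
have := ler_norm L; have : 0 <= enorm (X - x s) by exact: sqrtr_ge0.
by nra.
Qed.

Lemma is_derive_quotient (a : R -> R) (a' t : R) (G : set_system R) : Filter G ->
  is_derive t 1 a a' -> s @[s --> G] --> t -> (\forall s \near G, s != t) ->
  (a s - a t) / (s - t) @[s --> G] --> a'.
Proof.
move=> FG [da dv] Gt Gnt; apply/cvgrPdist_le => e e0.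
have cD : h^-1 *: (a (h *: 1 + t) - a t) @[h --> 0^'] --> a'.
  by rewrite -dv; exact: da.
have /cvgrPdist_le/(_ e e0)[d /= d0 hd] := cD.
have /cvgrPdist_lt/(_ d d0) := Gt; apply: filterS2 Gnt => s st sd.
have := hd (s - t); rewrite /= sub0r opprB => /(_ sd).
rewrite subr_eq0 => /(_ st).
by rewrite /GRing.scale /= mulr1 subrK mulrC.
Qed.

Lemma Rintegral_primitive_cvg (X phi : R -> R) : loc_integrable phi ->
  (forall a b, 0 <= a -> a <= b ->
    X b - X a = \int[lebesgue_measure]_(s in `[a, b]) phi s) ->
  (forall t, 0 <= t -> X s @[s --> t^'+] --> X t) /\
  (forall t, 0 < t -> X s @[s --> t^'-] --> X t).
Proof.
move=> iphi dX.
pose P s := X 0 + \int[lebesgue_measure]_(r in `[0, s]) phi r.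
have XP s : 0 <= s -> X s = P s.
  by move=> s0; rewrite /P -dX// addrC subrK.
have contP t : 0 <= t ->
    {within `[0, t + 1], continuous
      (fun s => \int[lebesgue_measure]_(r in `[0, s]) phi r)}.
  move=> t0; have t10 : 0 <= t + 1 by rewrite addr_ge0.
  exact: (parameterized_integral_continuous t10 (iphi _ t10)).
have inner t : 0 < t -> P s @[s --> t] --> P t.
  move=> t0; have t10 : 0 < t + 1 by rewrite addr_gt0.
  have /(continuous_within_itvP _ t10)[ct _ _] := contP t (ltW t0).
  apply: cvgD; first exact: cvg_cst.
  by apply: ct; rewrite in_itv/= t0 ltrDl ltr01.
split=> t t0; rewrite XP ?(ltW t0)//; last first.
  apply: (@cvg_trans _ (P s @[s --> t^'-])).
    apply: near_eq_cvg; near=> s; rewrite XP//.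
    by near: s; apply: filterS (nbhs_left_gt t0) => s /ltW.
  by apply: cvg_at_left_filter; exact: inner.
apply: (@cvg_trans _ (P s @[s --> t^'+])).
  apply: near_eq_cvg; near=> s; rewrite XP//.
  by rewrite (le_trans t0)//; near: s; exact: nbhs_right_ge.
move: t0; rewrite le_eqVlt => /predU1P[<-|t0]; last first.
  by apply: cvg_at_right_filter; exact: inner.
have /(continuous_within_itvP _ _)[|_ c0 _] := contP 0 (lexx 0).
  by rewrite add0r ltr01.
by apply: cvgD; first exact: cvg_cst.
Unshelve. all: by end_near. Qed.

End Limits.

(** * Pointwise inequalities for the Lyapunov function *)

Section Pointwise.
Context {R : realType} {n : nat}.
Implicit Types (u v w x y z : 'rV[R]_n).

Lemma kinetic_increment (w0 w1 : 'rV[R]_n) :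
  dotr w1 w1 / 2 - dotr w0 w0 / 2 <= dotr w1 (w1 - w0).
Proof.
have := dotrr_ge0 (w1 - w0).
by rewrite !dotrE [dotr w0 w1]dotrC; lra.
Qed.

Lemma gradient_monotone mu b (f : 'rV[R]_n -> R) x u : 0 <= b ->
  (forall x, differentiable f x) -> strongly_convex mu f ->
  dotr (grad f x - grad f (x + b *: u)) u <= - (mu * b * dotr u u).
Proof.
rewrite le_eqVlt => /predU1P[<-|b0] df cf.
  by rewrite scale0r addr0 subrr mulr0 mul0r oppr0 -(scale0r 0) dotrZl mul0r.
have h1 := strongly_convex_grad (x + b *: u) cf (df x).
have h2 := strongly_convex_grad x cf (df (x + b *: u)).
have e1 : x + b *: u - x = b *: u by rewrite addrC addKr.
have e2 : x - (x + b *: u) = - (b *: u) by rewrite opprD addNKr.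
rewrite {}e1 in h1; rewrite {}e2 in h2; move: h1 h2.
set q := grad f x; set q' := grad f _; rewrite !dotrE => h1 h2.
rewrite -(ler_pM2l b0); lra.
Qed.

(** With [y = x + b u], the gradient of [f] at [y] is removed by comparing the
    values of [f] at [y] and [xs], then those at [x] and [y]; the multiple
    [1 - a b] of [(grad f x - grad f y) . u] that remains is nonpositive by
    monotonicity.  The outcome is a quadratic form in [x - xs] and [u], and the
    last three conditions on the parameters concern its coefficients: in order,
    the square of the position, the product and the square of the velocity. *)
Lemma lyapunov_flow mu a a' b d (f : 'rV[R]_n -> R) (x xs u v : 'rV[R]_n) :
  0 < a -> 0 <= b -> a * b <= 1 -> a' + a ^+ 2 / 2 <= mu / 2 ->
  a' + 2 * a ^+ 2 - 2 * d * a - a * mu * b = 0 ->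
  3 / 2 * a - 2 * d - mu * b <= 0 ->
  (forall x, differentiable f x) -> strongly_convex mu f ->
  let w := a *: (x - xs) + u in
  dotr v w <= 0 ->
  dotr w (v - (2 * d) *: u - grad f (x + b *: u))
    + dotr (a *: w + grad f x) u
    + (a' * dotr w (x - xs) + a * (dotr w w / 2 + (f x - f xs))) <= 0.
Proof.
move=> a0 b0 ab czz czu cuu df cf w vw.
have h1 := strongly_convex_grad xs cf (df (x + b *: u)).
have h2 := strongly_convex_grad (x + b *: u) cf (df x).
have h3 := gradient_monotone x u b0 df cf.
have e1 : xs - (x + b *: u) = - ((x - xs) + b *: u).
  by rewrite !opprD opprK addrA [xs - x]addrC.
have e2 : x + b *: u - x = b *: u by rewrite addrC addKr.
rewrite {}e1 in h1; rewrite {}e2 in h2.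
move: vw h1 h2 h3; rewrite {}/w.
move: (x - xs) (grad f x) (grad f _) => z q q'.
rewrite !dotrE [dotr u z]dotrC ![dotr z q']dotrC ![dotr u q']dotrC.
rewrite ![dotr z v]dotrC ![dotr u v]dotrC => vw h1 h2 h3.
have zz := dotrr_ge0 z; have uu := dotrr_ge0 u.
have p1 := ler_wpM2l (ltW a0) h1.
have p2 := ler_wpM2l (ltW a0) h2.
have ab0 : 0 <= 1 - a * b by rewrite subr_ge0.
have p3 := ler_wpM2l ab0 h3.
have pzz := ler_wpM2l (mulr_ge0 (ltW a0) zz) czz.
have puu := ler_wpM2l uu cuu.
have pzu := congr1 (fun c => dotr z u * c) czu.
rewrite /= in pzu.
lra.
Qed.

(** Let [Sp] and [Sm] be the sums of the [L i * gamma_i] with the velocities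
    after and before the jump [D].  Concavity bounds the left-hand side by
    [(Sp + Sm) / 2].  Newton's impact law gives [Sp = - eps * Sm], and
    [Sp - Sm = |D|^2] because [D] is the combination of the gradients with
    weights [L i].  Hence [Sm <= 0], and
    [(Sp + Sm) / 2 = (1 - eps) * Sm / 2 <= 0]. *)
Lemma lyapunov_jump (ng : nat) (P : pred 'I_ng) eps a (g : 'I_ng -> 'rV[R]_n -> R)
    (x xs up um : 'rV[R]_n) (L : 'I_ng -> R) :
  0 <= eps <= 1 -> 0 <= a ->
  (forall i, differentiable (g i) x) -> (forall i, concave_fun (g i)) ->
  (forall i, 0 <= g i xs) ->
  up - um = \sum_(i < ng | P i) L i *: grad (g i) x ->
  (forall i, P i -> 0 <= L i /\
    L i * (gamma a (g i) x up + eps * gamma a (g i) x um) = 0) ->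
  dotr (a *: (x - xs) + 2^-1 *: (up + um)) (up - um) <= 0.
Proof.
move=> /andP[e0 e1] a0 dg cg gxs Dup LP.
pose Sp := \sum_(i < ng | P i) L i * gamma a (g i) x up.
pose Sm := \sum_(i < ng | P i) L i * gamma a (g i) x um.
have Spm : Sp + eps * Sm = 0.
  rewrite mulr_sumr -big_split /= big1// => i Pi.
  by have [_ <-] := LP i Pi; ring.
have SpB : Sp - Sm = dotr (up - um) (up - um).
  rewrite {1}Dup dotr_suml -sumrB; apply: eq_bigr => i Pi.
  by rewrite /gamma !dotrE; ring.
have le_mid : dotr (up - um) (a *: (x - xs) + 2^-1 *: (up + um)) <= (Sp + Sm) / 2.
  rewrite {1}Dup dotr_suml -big_split mulr_suml; apply: ler_sum => i Pi /=.
  have [L0 _] := LP i Pi.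
  have gz : dotr (grad (g i) x) (x - xs) <= g i x.
    by apply: le_trans (concave_grad_le xs (cg i) (dg i)) _; rewrite gerBl.
  have := ler_wpM2l L0 (ler_wpM2l a0 gz).
  by rewrite /gamma !dotrE; lra.
rewrite dotrC; apply: le_trans le_mid _.
have := dotrr_ge0 (up - um); rewrite -SpB => S0.
have Sm0 : Sm <= 0.
  rewrite leNgt; apply/negP => Sm0.
  by have := mulr_ge0 e0 (ltW Sm0); lra.
have e1' : 0 <= 1 - eps by rewrite subr_ge0.
by have := mulr_ge0_le0 e1' Sm0; lra.
Qed.

(** By concavity [grad (g i) x . (x - xs) <= g i x], so that the power of each
    reaction is at most [l i * gamma_i]. *)
Lemma reaction_power_le0 (ng : nat) (P : pred 'I_ng) a
    (g : 'I_ng -> 'rV[R]_n -> R) (x xs u : 'rV[R]_n) (l : 'I_ng -> R) :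
  0 <= a ->
  (forall i, differentiable (g i) x) -> (forall i, concave_fun (g i)) ->
  (forall i, 0 <= g i xs) ->
  (forall i, P i -> 0 <= l i /\ l i * gamma a (g i) x u = 0) ->
  dotr (\sum_(i < ng | P i) l i *: grad (g i) x) (a *: (x - xs) + u) <= 0.
Proof.
move=> a0 dg cg gxs lP; rewrite dotr_suml; apply: sumr_le0 => i Pi.
have [l0 <-] := lP i Pi.
have gz : dotr (grad (g i) x) (x - xs) <= g i x.
  by apply: le_trans (concave_grad_le xs (cg i) (dg i)) _; rewrite gerBl.
have := ler_wpM2l l0 (ler_wpM2l a0 gz).
by rewrite /gamma !dotrE; lra.
Qed.

End Pointwise.

(** * Trajectories of the inclusion *)

Section Coordinates.
Context {R : realType} {n : nat}.
Implicit Types (U X P Q : 'rV[R]_n).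

(** Velocity, position and time: the three integrators along a trajectory. *)
Definition coordinates (U X : 'rV[R]_n) (T : R) (k : ('I_n + 'I_n) + unit) : R :=
  match k with
  | inl (inl j) => U 0 j
  | inl (inr j) => X 0 j
  | inr _ => T
  end.

Lemma sum_coordinates P Q (S : R) U X (T : R) :
  \sum_k coordinates P Q S k * coordinates U X T k =
  dotr P U + dotr Q X + S * T.
Proof.
by rewrite !big_sumType /= (big_pred1 tt)//; case.
Qed.

Lemma coordinatesB U X (T : R) U' X' (T' : R) k :
  coordinates U X T k - coordinates U' X' T' k =
  coordinates (U - U') (X - X') (T - T') k.
Proof. by case: k => [[j|j]|[]] /=; rewrite ?mxE. Qed.

Lemma cvg_coordinates (G : set_system R) (P Q : R -> 'rV[R]_n) (S : R -> R)
    (P0 Q0 : 'rV[R]_n) (S0 : R) k : Filter G ->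
  P s @[s --> G] --> P0 -> Q s @[s --> G] --> Q0 -> S s @[s --> G] --> S0 ->
  coordinates (P s) (Q s) (S s) k @[s --> G] --> coordinates P0 Q0 S0 k.
Proof. by move=> FG cP cQ cS; case: k => [[j|j]|[]] //=; exact: cvg_coord. Qed.

End Coordinates.

(** All that the estimates use of a choice of parameters for a [mu]-strongly
    convex function ([mu = 0] when it is merely convex): [da] is the
    derivative of [alpha], and [r], the inverse of the rate, is the exponential
    of the integral of [alpha].  The conditions from [alpha_beta] to
    [velocity_cond] are those of [lyapunov_flow]. *)
Record lyapunov_parameters (R : realType) (mu : R) (p : parameters R)
    (da r : R -> R) : Prop := LyapunovParameters {
  modulus_ge0 : 0 <= mu;
  alpha_gt0 : forall t : R, 0 <= t -> 0 < alpha p t;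
  beta_ge0 : forall t : R, 0 <= t -> 0 <= beta p t;
  alpha_beta : forall t : R, 0 <= t -> alpha p t * beta p t <= 1;
  position_cond : forall t : R, 0 <= t -> da t + alpha p t ^+ 2 / 2 <= mu / 2;
  cross_cond : forall t : R, 0 <= t ->
    da t + 2 * alpha p t ^+ 2 - 2 * delta p t * alpha p t
    - alpha p t * mu * beta p t = 0;
  velocity_cond : forall t : R, 0 <= t ->
    3 / 2 * alpha p t - 2 * delta p t - mu * beta p t <= 0;
  derive_alpha : forall t : R, 0 <= t -> is_derive t 1 (alpha p) (da t);
  derive_r : forall t : R, 0 <= t -> is_derive t 1 r (alpha p t * r t);
  da_continuous : forall t : R, 0 <= t -> {for t, continuous da};
  r_gt0 : forall t : R, 0 <= t -> 0 < r t;
  r_0 : r 0 = 1;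
  rate_r : forall t : R, 0 <= t -> rate p t = (r t)^-1 }.

Section Trajectory.
Context {R : realType} {n ng : nat}.
Context (f : 'rV[R]_n -> R) (g : 'I_ng -> 'rV[R]_n -> R) (p : parameters R).
Context (eps : R) (x u up um udot : R -> 'rV[R]_n) (lam Lam : 'I_ng -> R -> R).
Hypothesis traj : inclusion f g p eps x u up um udot lam Lam.
Local Notation mu := (@lebesgue_measure R).

Let K : finType := ('I_n + 'I_n + unit)%type.
Let Yp (k : K) (s : R) := coordinates (up s) (x s) s k.
Let Ym (k : K) (s : R) := coordinates (um s) (x s) s k.
Let phi (k : K) (s : R) := coordinates (udot s) (u s) 1 k.
Let psi (k : K) (s : R) := coordinates (up s - um s) 0 0 k.

Let loc_summable0 : loc_summable (fun=> 0 : R).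
Proof. by move=> T _; rewrite /summable esum1//= => s _; rewrite normr0. Qed.

Lemma trajectory_differential k :
  differential (Yp k) (Ym k) (phi k) (psi k).
Proof.
case: k => [[j|j]|[]]; split.
- exact: (udot_integrable traj).
- exact: (jump_summable traj).
- by move=> a b a0 ab; rewrite /Yp /Ym /= (du_eq traj).
- exact: (u_integrable traj).
- rewrite (_ : psi _ = fun=> 0); last by apply/funext => s; rewrite /psi /= mxE.
  exact: loc_summable0.
- move=> a b a0 ab; rewrite (_ : psi _ = fun=> 0); last first.
    by apply/funext => s; rewrite /psi /= mxE.
  by rewrite atomic_sum0 addr0 /Yp /Ym /= (dx_eq traj).
- move=> T T0; apply: continuous_compact_integrable; first exact: segment_compact.
  by apply: continuous_subspaceT => s; exact: cvg_cst.
- exact: loc_summable0.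
- move=> a b a0 ab; rewrite atomic_sum0 addr0 /Yp /Ym /=.
  have -> : \int[mu]_(s in `[a, b]) phi (inr tt) s = 1 * fine (mu `[a, b]%classic).
    exact: Rintegral_cst.
  rewrite mul1r lebesgue_measure_itv /= lte_fin.
  by move: ab; rewrite le_eqVlt => /predU1P[->|->]; rewrite ?ltxx ?subrr.
Qed.

Lemma position_right t : 0 <= t -> x s @[s --> t^'+] --> x t.
Proof.
move=> t0; apply: cvg_row => j.
have [h _] := Rintegral_primitive_cvg (u_integrable traj j)
  (fun a b => dx_eq traj j (a := a) (b := b)).
exact: h.
Qed.

Lemma position_left t : 0 < t -> x s @[s --> t^'-] --> x t.
Proof.
move=> t0; apply: cvg_row => j.
have [_ h] := Rintegral_primitive_cvg (u_integrable traj j)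
  (fun a b => dx_eq traj j (a := a) (b := b)).
exact: h.
Qed.

Lemma up_right t : 0 <= t -> up s @[s --> t^'+] --> up t.
Proof.
move=> t0; apply: (cvg_one_sided_limits (H := fun s => s^'+) _ _
  (@near_right_near _ t) _ (u_right traj t0)).
- by move=> s; exact: cvg_within.
- apply: filterS (nbhs_right_ge t) => s ts.
  exact: (u_right traj (le_trans t0 ts)).
Qed.

Lemma um_right t : 0 <= t -> um s @[s --> t^'+] --> up t.
Proof.
move=> t0; apply: (cvg_one_sided_limits (H := fun s => s^'-) _ _
  (@near_right_near _ t) _ (u_right traj t0)).
- by move=> s; exact: cvg_within.
- apply: filterS (nbhs_right_gt t) => s ts.
  exact: (u_left traj (le_lt_trans t0 ts)).
Qed.

Lemma up_left t : 0 < t -> up s @[s --> t^'-] --> um t.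
Proof.
move=> t0; apply: (cvg_one_sided_limits (H := fun s => s^'+) _ _
  (@near_left_near _ t) _ (u_left traj t0)).
- by move=> s; exact: cvg_within.
- apply: filterS (nbhs_left_gt t0) => s s0.
  exact: (u_right traj (ltW s0)).
Qed.

Lemma um_left t : 0 < t -> um s @[s --> t^'-] --> um t.
Proof.
move=> t0; apply: (cvg_one_sided_limits (H := fun s => s^'-) _ _
  (@near_left_near _ t) _ (u_left traj t0)).
- by move=> s; exact: cvg_within.
- apply: filterS (nbhs_left_gt t0) => s s0.
  exact: (u_left traj s0).
Qed.


(** * Decay of the Lyapunov function *)

Section Lyapunov.
Context (m : R) (da r : R -> R) (xs : 'rV[R]_n).
Hypothesis par : lyapunov_parameters m p da r.
Hypothesis f_smooth : smooth 1 f.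
Hypothesis f_convex : strongly_convex m f.
Hypothesis g_smooth : forall i, exists L : R, smooth L (g i).
Hypothesis g_concave : forall i, concave_fun (g i).
Hypothesis xs_feasible : forall i, 0 <= g i xs.
Hypothesis eps01 : 0 <= eps < 1.

Let a := alpha p.

Definition mixed v (s : R) : 'rV[R]_n := a s *: (x s - xs) + v.

Definition energy v (s : R) : R :=
  dotr (mixed v s) (mixed v s) / 2 + (f (x s) - f xs).

(** The differential of [r * energy] with respect to velocity, position and
    time. *)
Definition energy_differential v (s : R) : K -> R :=
  coordinates (r s *: mixed v s) (r s *: (a s *: mixed v s + grad f (x s)))
    (r s * da s * dotr (mixed v s) (x s - xs) + a s * r s * energy v s).

Let is_derive_continuous (h : R -> R) (t l : R) :
  is_derive t 1 h l -> {for t, continuous h}.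
Proof. by move=> [/derivable1_diffP/differentiable_continuous]. Qed.

Let cvg_along (G : set_system R) (h : R -> R) (t : R) : Filter G ->
  {for t, continuous h} -> G --> t -> h s @[s --> G] --> h t.
Proof. by move=> FG ch Gt; exact: (cvg_comp id h Gt ch). Qed.

Section Convergence.
Context (G : set_system R) (t : R) (v : R -> 'rV[R]_n) (v0 : 'rV[R]_n).
Hypothesis t0 : 0 <= t.
Hypothesis FG : Filter G.
Hypothesis Gt : G --> t.
Hypothesis xt : x s @[s --> G] --> x t.
Hypothesis vt : v s @[s --> G] --> v0.

Lemma cvg_alpha : a s @[s --> G] --> a t.
Proof. exact: cvg_along (is_derive_continuous (derive_alpha par t0)) Gt. Qed.

Lemma cvg_r : r s @[s --> G] --> r t.
Proof. exact: cvg_along (is_derive_continuous (derive_r par t0)) Gt. Qed.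

Lemma cvg_error : x s - xs @[s --> G] --> x t - xs.
Proof. by apply: cvgB => //; exact: cvg_cst. Qed.

Lemma cvg_mixed : mixed (v s) s @[s --> G] --> mixed v0 t.
Proof. by apply: cvgD => //; apply: cvgZ; [exact: cvg_alpha|exact: cvg_error]. Qed.

Lemma cvg_f : f (x s) @[s --> G] --> f (x t).
Proof.
have cf := differentiable_continuous (proj1 f_smooth (x t)).
exact: (cvg_comp x f xt cf).
Qed.

Lemma cvg_energy : energy (v s) s @[s --> G] --> energy v0 t.
Proof.
apply: cvgD; first by apply: cvgM; [apply: cvg_dotr; exact: cvg_mixed|exact: cvg_cst].
by apply: cvgB; [exact: cvg_f|exact: cvg_cst].
Qed.

Lemma cvg_energy_velocity : r s *: mixed (v s) s @[s --> G] --> r t *: mixed v0 t.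
Proof. by apply: cvgZ; [exact: cvg_r|exact: cvg_mixed]. Qed.

Lemma cvg_energy_position :
  r s *: (a s *: mixed (v s) s + grad f (x s)) @[s --> G]
    --> r t *: (a t *: mixed v0 t + grad f (x t)).
Proof.
apply: cvgZ; first exact: cvg_r.
apply: cvgD; first by apply: cvgZ; [exact: cvg_alpha|exact: cvg_mixed].
exact: cvg_grad f_smooth xt.
Qed.

Lemma cvg_energy_differential k :
  energy_differential (v s) s k @[s --> G] --> energy_differential v0 t k.
Proof.
apply: cvg_coordinates.
- exact: cvg_energy_velocity.
- exact: cvg_energy_position.
apply: cvgD; last first.
  apply: cvgM; last exact: cvg_energy.
  by apply: cvgM; [exact: cvg_alpha|exact: cvg_r].
apply: cvgM; last by apply: cvg_dotr; [exact: cvg_mixed|exact: cvg_error].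
apply: cvgM; first exact: cvg_r.
exact: cvg_along (da_continuous par t0) Gt.
Qed.

End Convergence.

Lemma energy_flow : {ae mu, forall s : R, 0 <= s -> [set: R] s ->
  \sum_k energy_differential (u s) s k * phi k s <= 0}.
Proof.
apply: filterS (flow traj); first exact: (ae_filter_ringOfSetsType mu).
move=> s flow_s s0 _; rewrite sum_coordinates mulr1.
have [eq_u comp] := flow_s s0.
have r0 := r_gt0 par s0.
set vreac := \sum_(i < ng | _) _ in eq_u.
have -> : udot s = vreac - (2 * delta p s) *: u s - grad f (x s + beta p s *: u s).
  by rewrite -eq_u [in RHS]addrAC addrK addrK.
have reac : dotr vreac (mixed (u s) s) <= 0.
  apply: reaction_power_le0 => //; first exact: ltW (alpha_gt0 par s0).
    by move=> i; have [L []] := g_smooth i.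
  by move=> i /comp [].
have := lyapunov_flow (alpha_gt0 par s0) (beta_ge0 par s0) (alpha_beta par s0)
  (position_cond par s0) (cross_cond par s0) (velocity_cond par s0)
  (proj1 f_smooth) f_convex reac.
move=> /(ler_wpM2l (ltW r0)); rewrite mulr0; apply: le_trans.
rewrite !(dotrZl (r s)) /energy le_eqVlt; apply/orP; left; apply/eqP.
by rewrite /a /mixed; ring.
Qed.

Lemma jump_power_le0 (s : R) : 0 <= s ->
  dotr (mixed (2^-1 *: (up s + um s)) s) (up s - um s) <= 0.
Proof.
move=> s0; have [eq_u comp] := impact traj s0; have /andP[e0 e1] := eps01.
apply: (lyapunov_jump (eps := eps) _ _ _ g_concave xs_feasible eq_u).
- by rewrite e0 ltW.
- exact: ltW (alpha_gt0 par s0).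
- by move=> i; have [L []] := g_smooth i.
- by move=> i /comp [].
Qed.

Lemma energy_jump (s : R) : 0 <= s -> [set: R] s ->
  \sum_k energy_differential (2^-1 *: (up s + um s)) s k * psi k s <= 0.
Proof.
move=> s0 _; rewrite sum_coordinates mulr0 addr0.
rewrite [X in _ + X](_ : _ = 0) ?addr0; last first.
  by rewrite -(scale0r 0) dotrZr mul0r.
rewrite dotrZl; apply: mulr_ge0_le0; first exact: ltW (r_gt0 par s0).
exact: jump_power_le0.
Qed.

Lemma energy_drop (s : R) : 0 <= s -> energy (up s) s <= energy (um s) s.
Proof.
move=> s0; have := jump_power_le0 s0; rewrite /energy /mixed.
move: (a s *: (x s - xs)) (up s) (um s) => z v1 v0.
rewrite !dotrE [dotr v0 v1]dotrC [dotr v1 z]dotrC [dotr v0 z]dotrC; lra.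
Qed.

(** The energy is a convex function of [mixed] plus a convex function of the
    position, so its increments are bounded by the differentials at the later
    state. *)
Lemma energy_increment v0 v1 (s0 s1 : R) : 0 <= s1 -> s1 != s0 ->
  r s1 * energy v1 s1 - r s0 * energy v0 s0 <=
  dotr (r s1 *: mixed v1 s1) (v1 - v0)
  + dotr (r s1 *: (a s1 *: mixed v1 s1 + grad f (x s1))) (x s1 - x s0)
  + (r s1 * ((a s1 - a s0) / (s1 - s0)) * dotr (mixed v1 s1) (x s0 - xs)
     + (r s1 - r s0) / (s1 - s0) * energy v0 s0) * (s1 - s0).
Proof.
move=> s10 s10n; have r1 := r_gt0 par s10.
have ds : s1 - s0 != 0 by rewrite subr_eq0.
have -> : forall A B C D : R, (A * (B / (s1 - s0)) * C + D / (s1 - s0) *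
    energy v0 s0) * (s1 - s0) = A * B * C + D * energy v0 s0.
  by move=> A B C D; field.
have dm : mixed v1 s1 - mixed v0 s0 =
    (v1 - v0) + a s1 *: (x s1 - x s0) + (a s1 - a s0) *: (x s0 - xs).
  rewrite /mixed !(scalerBl, scalerBr); apply/rowP => j; rewrite !mxE; ring.
have fgrad : f (x s1) - f (x s0) <= dotr (grad f (x s1)) (x s1 - x s0).
  have := strongly_convex_grad (x s0) f_convex ((proj1 f_smooth) (x s1)).
  have := mulr_ge0 (modulus_ge0 par) (dotrr_ge0 (x s0 - x s1)).
  by rewrite -[x s0 - x s1]opprB [dotr (grad _ _) _]dotrNr; lra.
have en : energy v1 s1 - energy v0 s0 <=
    dotr (mixed v1 s1) (v1 - v0) + a s1 * dotr (mixed v1 s1) (x s1 - x s0)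
    + (a s1 - a s0) * dotr (mixed v1 s1) (x s0 - xs)
    + dotr (grad f (x s1)) (x s1 - x s0).
  rewrite /energy; have := kinetic_increment (mixed v0 s0) (mixed v1 s1).
  rewrite dm; move: (mixed v0 s0) (mixed v1 s1) => w0 w1.
  move: (v1 - v0) (x s1 - x s0) (x s0 - xs) fgrad => dv dx z fgrad.
  by rewrite !dotrDr !dotrZr; lra.
have := ler_wpM2l (ltW r1) en; rewrite /energy.
move: (mixed v0 s0) (mixed v1 s1) => w0 w1.
move: (v1 - v0) (x s1 - x s0) (x s0 - xs) => dv dx z.
by rewrite !dotrZl dotrDl dotrZl; lra.
Qed.

Local Notation V := (total_variation phi psi).

Let half_double (v : 'rV[R]_n) : 2^-1 *: (v + v) = v.
Proof. by apply/rowP => j; rewrite !mxE; lra. Qed.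

Lemma energy_right (t : R) : 0 <= t -> forall e, 0 < e ->
  \forall s \near t^'+,
    r s * energy (um s) s - r t * energy (up t) t <= e * (V s - V t).
Proof.
move=> t0.
have Gt : t^'+ --> t by exact: cvg_within.
have xt := position_right t0.
pose S s := r s * ((a s - a t) / (s - t)) * dotr (mixed (um s) s) (x t - xs)
            + (r s - r t) / (s - t) * energy (up t) t.
apply: (right_estimate trajectory_differential (A := setT)
  (F := fun t s => r s * energy (um s) s - r t * energy (up t) t)
  (ci := fun s => coordinates (r s *: mixed (um s) s)
           (r s *: (a s *: mixed (um s) s + grad f (x s))) (S s))
  (c := energy_differential (up t) t) energy_flow energy_jump t0).
- exact: filterT.
- move=> k; apply: cvg_coordinates.
  + by apply: cvg_energy_velocity => //; exact: um_right.
  + by apply: cvg_energy_position => //; exact: um_right.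
  + have dq (h : R -> R) (l : R) : is_derive t 1 h l ->
        (h s - h t) / (s - t) @[s --> t^'+] --> l.
      by move=> dh; apply: is_derive_quotient dh Gt _; exact: nbhs_right_neq.
    apply: cvgD; last first.
      by apply: cvgM; [exact: dq (derive_r par t0)|exact: cvg_cst].
    apply: cvgM; last first.
      by apply: cvg_dotr; [apply: cvg_mixed => //; exact: um_right|exact: cvg_cst].
    by apply: cvgM; [exact: cvg_r|exact: dq (derive_alpha par t0)].
- by move=> k; apply: cvg_energy_differential => //; exact: (u_right traj).
- move=> k; apply: cvg_energy_differential => //.
  rewrite -(half_double (up t)).
  apply: cvgZ; first exact: cvg_cst.
  by apply: cvgD; [exact: up_right|exact: um_right].
- near=> s.
  have ts : t < s by near: s; exact: nbhs_right_gt.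
  have s0 : 0 <= s by rewrite (le_trans t0)// ltW.
  under eq_bigr do rewrite coordinatesB.
  rewrite sum_coordinates; by apply: energy_increment => //; rewrite gt_eqF.
Unshelve. all: by end_near. Qed.

Lemma energy_left (t : R) : 0 < t -> forall e, 0 < e ->
  \forall s \near t^'-,
    r t * energy (um t) t - r s * energy (up s) s <= e * (V t - V s).
Proof.
move=> t0; have t0W := ltW t0.
have Gt : t^'- --> t by exact: cvg_within.
have xt := position_left t0.
pose S s := r t * ((a t - a s) / (t - s)) * dotr (mixed (um t) t) (x s - xs)
            + (r t - r s) / (t - s) * energy (up s) s.
apply: (left_estimate trajectory_differential (A := setT)
  (F := fun s t => r t * energy (um t) t - r s * energy (up s) s)
  (ci := fun s => coordinates (r t *: mixed (um t) t)
           (r t *: (a t *: mixed (um t) t + grad f (x t))) (S s))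
  (c := energy_differential (um t) t) energy_flow energy_jump t0).
- exact: filterT.
- move=> k; apply: cvg_coordinates; [exact: cvg_cst|exact: cvg_cst|].
  have dq (h : R -> R) (l : R) : is_derive t 1 h l ->
      (h t - h s) / (t - s) @[s --> t^'-] --> l.
    move=> dh; apply: (@cvg_trans _ ((h s - h t) / (s - t) @[s --> t^'-])); last first.
      exact: (is_derive_quotient _ dh Gt (nbhs_left_neq t)).
    apply: near_eq_cvg; near=> s.
    by rewrite -[h s - h t]opprB -[s - t]opprB invrN mulrNN.
  apply: cvgD; last first.
    apply: cvgM; first exact: dq (derive_r par t0W).
    by apply: cvg_energy => //; exact: up_left.
  apply: cvgM; last first.
    by apply: cvg_dotr; [exact: cvg_cst|exact: cvg_error].
  by apply: cvgM; [exact: cvg_cst|exact: dq (derive_alpha par t0W)].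
- by move=> k; apply: cvg_energy_differential => //; exact: (u_left traj).
- move=> k; apply: cvg_energy_differential => //.
  rewrite -(half_double (um t)).
  apply: cvgZ; first exact: cvg_cst.
  by apply: cvgD; [exact: up_left|exact: um_left].
- near=> s.
  have st : s < t by near: s; exact: nbhs_left_lt.
  under eq_bigr do rewrite coordinatesB.
  rewrite sum_coordinates; by apply: energy_increment => //; rewrite gt_eqF.
Unshelve. all: by end_near. Qed.

Let le_of_slack (A B C : R) : (forall e, 0 < e -> A <= B + e * C) -> A <= B.
Proof.
move=> h; rewrite leNgt; apply/negP => BA.
have C1 : 0 < `|C| + 1 by rewrite ltr_wpDl.
have := h ((A - B) / 2 / (`|C| + 1)); rewrite !divr_gt0 ?subr_gt0// => /(_ isT).
have : (A - B) / 2 / (`|C| + 1) * C <= (A - B) / 2.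
  rewrite mulrAC ler_pdivrMr// ler_wpM2l ?divr_ge0 ?subr_ge0 ?(ltW BA)//.
  by rewrite (le_trans (ler_norm C))// lerDl.
lra.
Qed.

(** At [t], the jump is added to the estimate on the left, since [r] is positive
    and the energy does not increase at impacts. *)
Lemma energy_decay (t : R) : 0 <= t ->
  r t * energy (up t) t <= energy (um 0) 0.
Proof.
move=> t0; apply: le_trans (energy_drop (lexx 0)).
rewrite -[leRHS]mul1r -(r_0 par).
apply: (@le_of_slack _ _ (V t - V 0)) => e e0; rewrite -lerBlDl.
have drop s : 0 <= s -> r s * energy (up s) s <= r s * energy (um s) s.
  by move=> s0; rewrite ler_wpM2l ?energy_drop// ltW ?(r_gt0 par s0).
apply: (local_to_global
  (P := fun s t => r t * energy (up t) t - r s * energy (up s) s <= e * (V t - V s))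
  t0).
- by move=> s; rewrite !subrr mulr0.
- by move=> s1 s2 s3; lra.
- move=> s /andP[s0 _]; near=> s'.
  have s'0 : 0 <= s' by rewrite (le_trans s0)//; near: s'; exact: nbhs_right_ge.
  suff : r s' * energy (um s') s' - r s * energy (up s) s <= e * (V s' - V s).
    by have := drop _ s'0; lra.
  by near: s'; exact: energy_right.
- move=> s /andP[s0 _]; near=> s'.
  suff : r s * energy (um s) s - r s' * energy (up s') s' <= e * (V s - V s').
    by have := drop _ (ltW s0); lra.
  by near: s'; exact: energy_left.
Unshelve. all: by end_near. Qed.

(** * Decay of the constraint violation *)

Section Violation.
Context (i : 'I_ng).
Local Notation G := (fun s => g i (x s)).

Definition constraint_differential (s : R) : K -> R :=
  coordinates 0 (- r s *: grad (g i) (x s)) (- (a s * r s) * G s).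

Let g_differentiable y : differentiable (g i) y.
Proof. by have [L []] := g_smooth i. Qed.

Let dotr0l (v : 'rV[R]_n) : dotr 0 v = 0.
Proof. by rewrite -(scale0r 0) dotrZl mul0r. Qed.

Lemma constraint_flow : {ae mu, forall s : R, 0 <= s -> [set s | G s < 0] s ->
  \sum_k constraint_differential s k * phi k s <= 0}.
Proof.
apply: filterS (flow traj); first exact: (ae_filter_ringOfSetsType mu).
move=> s flow_s s0 Gs; rewrite sum_coordinates dotr0l.
have [_ /(_ i (ltW Gs))[_ gam0 _]] := flow_s s0.
have := mulr_ge0 (ltW (r_gt0 par s0)) gam0.
by rewrite /gamma dotrZl /a; lra.
Qed.

Lemma constraint_jump (s : R) : 0 <= s -> [set s | G s < 0] s ->
  \sum_k constraint_differential s k * psi k s <= 0.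
Proof.
by move=> _ _; rewrite sum_coordinates dotr0l dotrC dotr0l mulr0 !addr0.
Qed.

Lemma constraint_increment (s0 s1 : R) : 0 <= s1 -> s1 != s0 ->
  r s0 * G s0 - r s1 * G s1 <=
  dotr (- r s1 *: grad (g i) (x s1)) (x s1 - x s0)
  - (r s1 - r s0) / (s1 - s0) * G s0 * (s1 - s0).
Proof.
move=> s10 s10n; have r1 := r_gt0 par s10.
have ds : s1 - s0 != 0 by rewrite subr_eq0.
have -> : (r s1 - r s0) / (s1 - s0) * G s0 * (s1 - s0) = (r s1 - r s0) * G s0.
  by field.
have := concave_grad_le (x s0) (g_concave i) (g_differentiable (x s1)).
by move=> /(ler_wpM2l (ltW r1)); rewrite dotrZl; lra.
Qed.

Lemma cvg_constraint (F : set_system R) (t : R) : Filter F ->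
  x s @[s --> F] --> x t -> G s @[s --> F] --> G t.
Proof.
move=> FF xt; have cg := differentiable_continuous (g_differentiable (x t)).
exact: (cvg_comp x (g i) xt cg).
Qed.

Section Convergence.
Context (F : set_system R) (t : R) (t0 : 0 <= t) (FF : Filter F) (Ft : F --> t).
Context (xt : x s @[s --> F] --> x t).

Lemma cvg_constraint_position :
  - r s *: grad (g i) (x s) @[s --> F] --> - r t *: grad (g i) (x t).
Proof.
have [L gL] := g_smooth i.
by apply: cvgZ; [apply: cvgN; exact: cvg_r|exact: cvg_grad gL xt].
Qed.

Lemma cvg_constraint_differential k :
  constraint_differential s k @[s --> F] --> constraint_differential t k.
Proof.
apply: cvg_coordinates; [exact: cvg_cst|exact: cvg_constraint_position|].
apply: cvgM; last exact: cvg_constraint.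
by apply: cvgN; apply: cvgM; [exact: cvg_alpha|exact: cvg_r].
Qed.

End Convergence.

Lemma constraint_right (t : R) : 0 <= t -> G t < 0 -> forall e, 0 < e ->
  \forall s \near t^'+, r t * G t - r s * G s <= e * (V s - V t).
Proof.
move=> t0 Gt0.
have Gt : t^'+ --> t by exact: cvg_within.
have xt := position_right t0.
apply: (right_estimate trajectory_differential (A := [set s | G s < 0])
  (F := fun t s => r t * G t - r s * G s)
  (ci := fun s => coordinates 0 (- r s *: grad (g i) (x s))
           (- ((r s - r t) / (s - t)) * G t))
  (c := constraint_differential t) constraint_flow constraint_jump t0).
- exact: cvgr_lt (cvg_constraint _ xt) _ Gt0.
- move=> k; apply: cvg_coordinates.
  + exact: cvg_cst.
  + exact: cvg_constraint_position.
  + apply: cvgM; last exact: cvg_cst.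
    by apply: cvgN; apply: is_derive_quotient _ (derive_r par t0) Gt (nbhs_right_neq t).
- by move=> k; exact: cvg_constraint_differential.
- by move=> k; exact: cvg_constraint_differential.
- near=> s.
  have ts : t < s by near: s; exact: nbhs_right_gt.
  have s0 : 0 <= s by rewrite (le_trans t0)// ltW.
  under eq_bigr do rewrite coordinatesB.
  rewrite sum_coordinates dotr0l add0r.
  have := constraint_increment s0 (negbT (gt_eqF ts)); lra.
Unshelve. all: by end_near. Qed.

Lemma constraint_left (t : R) : 0 < t -> G t < 0 -> forall e, 0 < e ->
  \forall s \near t^'-, r s * G s - r t * G t <= e * (V t - V s).
Proof.
move=> t0 Gt0; have t0W := ltW t0.
have Gt : t^'- --> t by exact: cvg_within.
have xt := position_left t0.
apply: (left_estimate trajectory_differential (A := [set s | G s < 0])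
  (F := fun s t => r s * G s - r t * G t)
  (ci := fun s => coordinates 0 (- r t *: grad (g i) (x t))
           (- ((r t - r s) / (t - s)) * G s))
  (c := constraint_differential t) constraint_flow constraint_jump t0).
- exact: cvgr_lt (cvg_constraint _ xt) _ Gt0.
- move=> k; apply: cvg_coordinates; [exact: cvg_cst|exact: cvg_cst|].
  apply: cvgM; last exact: cvg_constraint.
  apply: cvgN; apply: (@cvg_trans _ ((r s - r t) / (s - t) @[s --> t^'-])); last first.
    exact: (is_derive_quotient _ (derive_r par t0W) Gt (nbhs_left_neq t)).
  apply: near_eq_cvg; near=> s.
  by rewrite -[r s - r t]opprB -[s - t]opprB invrN mulrNN.
- by move=> k; exact: cvg_constraint_differential.
- by move=> k; exact: cvg_constraint_differential.
- near=> s.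
  have st : s < t by near: s; exact: nbhs_left_lt.
  under eq_bigr do rewrite coordinatesB.
  rewrite sum_coordinates dotr0l add0r.
  have := constraint_increment t0W (negbT (gt_eqF st)); lra.
Unshelve. all: by end_near. Qed.

Let V_ge0 t : 0 <= V t.
Proof.
apply: sumr_ge0 => k _; apply: addr_ge0.
  by apply: Rintegral_ge0 => s _.
exact: atomic_sum_ge0.
Qed.

(** What is propagated is a lower bound with a margin
    [e * (1 + V t)] below the nonpositive number [c].  While [g i] is negative,
    the growth of [V] pays for the errors of the local estimates; near the times
    at which [g i] vanishes, where its sign may oscillate, the bound holds by
    continuity, thanks to the margin. *)
Lemma constraint_decay (t : R) : 0 <= t -> Num.min 0 (G 0) <= r t * G t.
Proof.
move=> t0; set c := Num.min _ _.
have c0 : c <= 0 by rewrite ge_min lexx.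
apply: (@le_of_slack _ _ (1 + V t)) => e e0; rewrite -lerBlDr.
suff : (c - e * (1 + V 0) <= r 0 * G 0) -> (c - e * (1 + V t) <= r t * G t).
  apply; rewrite (r_0 par) mul1r lerBlDr (le_trans (y := G 0))//.
    by rewrite ge_min lexx orbT.
  by rewrite lerDl mulr_ge0// ?(ltW e0)// addr_ge0.
apply: (local_to_global (P := fun s t => (c - e * (1 + V s) <= r s * G s) ->
  (c - e * (1 + V t) <= r t * G t)) t0) => //.
- by move=> s1 s2 s3 h1 h2 /h1.
- move=> s /andP[s0 _]; have [Gs0|Gs0] := ltP (G s) 0.
    near=> s'; have : r s * G s - r s' * G s' <= e * (V s' - V s).
      by near: s'; exact: constraint_right.
    lra.
  near=> s' => _.
  have : - e <= r s' * G s'.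
    near: s'; apply: (@cvgr_ge _ _ _ _ _ (r s * G s)).
      apply: cvgM; first by apply: cvg_r => //; exact: cvg_within.
      exact: cvg_constraint (position_right s0).
    by rewrite (lt_le_trans (y := 0))// ?oppr_lt0// mulr_ge0// ltW// (r_gt0 par).
  by have := mulr_ge0 (ltW e0) (V_ge0 s'); lra.
- move=> s /andP[s0 _]; have [Gs0|Gs0] := ltP (G s) 0.
    near=> s'; have : r s' * G s' - r s * G s <= e * (V s - V s').
      by near: s'; exact: constraint_left.
    lra.
  near=> s' => _.
  have := mulr_ge0 (ltW (r_gt0 par (ltW s0))) Gs0.
  by have := mulr_ge0 (ltW e0) (V_ge0 s); lra.
Unshelve. all: by end_near. Qed.

End Violation.
End Lyapunov.
End Trajectory.

(** * The three choices of parameters *)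

Section Schemes.
Context {R : realType}.
Implicit Types (mu t : R).

Lemma is_derive_scaled_expR (c t : R) :
  is_derive t 1 (fun s => expR (c * s)) (c * expR (c * t)).
Proof.
have d : is_derive t (1 : R) (fun s : R => c * s) c.
  have := is_deriveZ c (is_derive_id t (1 : R)).
  by rewrite /GRing.scale /= mulr1.
by rewrite mulrC; apply: (is_derive1_comp (f := expR)).
Qed.

Lemma heavy_ball_lyapunov mu : 0 < mu ->
  lyapunov_parameters mu (heavy_ball mu) (fun=> 0)
    (fun t => expR (Num.sqrt mu * t)).
Proof.
move=> mu0; have s0 : 0 < Num.sqrt mu by rewrite sqrtr_gt0.
have ss : Num.sqrt mu ^+ 2 = mu by rewrite sqr_sqrtr// ltW.
split=> //=; first exact: ltW.
- by move=> t _; rewrite ss add0r.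
- by move=> t _; rewrite mulr0 subr0; ring.
- by move=> t _; lra.
- by move=> t _; exact: is_derive_cst.
- by move=> t _; exact: is_derive_scaled_expR.
- by move=> t _; exact: cvg_cst.
- by move=> t _; exact: expR_gt0.
- by rewrite mulr0 expR0.
- by move=> t _; rewrite mulNr expRN.
Qed.

Lemma nesterov_constant_lyapunov mu : 0 < mu <= 1 ->
  lyapunov_parameters mu (nesterov_constant mu) (fun=> 0)
    (fun t => expR ((Num.sqrt mu - mu / 2) * t)).
Proof.
move=> /andP[mu0 mu1].
have : Num.sqrt mu ^+ 2 = mu by rewrite sqr_sqrtr// ltW.
have : 0 < Num.sqrt mu by rewrite sqrtr_gt0.
rewrite /nesterov_constant; move: (Num.sqrt mu) => s s0 ss.
have s1 : s <= 1 by rewrite -(ler_pXn2r (n := 2)) ?nnegrE ?(ltW s0)// ss expr1n.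
have s1n0 : 1 + s != 0 by rewrite gt_eqF// addr_gt0.
have a0 : 0 < s - mu / 2 by rewrite -ss expr2; nra.
have b0 : 0 <= (1 - s) / (1 + s) by rewrite divr_ge0 ?subr_ge0// addr_ge0 ?ltW.
split=> //=; first exact: ltW.
- move=> t _; have b1 : (1 - s) / (1 + s) <= 1.
    by rewrite ler_pdivrMr ?addr_gt0//; lra.
  have a1 : s - mu / 2 <= 1 by lra.
  by rewrite -[leRHS]mulr1; apply: ler_pM => //; exact: ltW.
- by move=> t _; rewrite add0r -ss; nra.
- by move=> t _; rewrite -ss; field.
- move=> t _; rewrite -ss.
  have -> : 3 / 2 * (s - s ^+ 2 / 2) - 2 * (s / (1 + s))
      - s ^+ 2 * ((1 - s) / (1 + s)) = - ((s - s ^+ 2 / 2) / 2) by field.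
  by rewrite oppr_le0 divr_ge0// ss ltW.
- by move=> t _; exact: is_derive_cst.
- by move=> t _; exact: is_derive_scaled_expR.
- by move=> t _; exact: cvg_cst.
- by move=> t _; exact: expR_gt0.
- by rewrite mulr0 expR0.
- by move=> t _; rewrite mulNr expRN.
Qed.

Lemma nesterov_varying_lyapunov :
  lyapunov_parameters (0 : R) nesterov_varying (fun t => - (2 / (t + 3) ^+ 2))
    (fun t => (t + 3) ^+ 2 / 9).
Proof.
have t3 t : 0 <= t -> 0 < t + 3 by lra.
have t3n t : 0 <= t -> t + 3 != 0 by move=> /t3; rewrite lt0r => /andP[].
have d3 t : is_derive t (1 : R) (fun s : R => s + 3) 1.
  have := is_deriveD (is_derive_id t (1 : R)) (is_derive_cst (3 : R) t (1 : R)).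
  by rewrite addr0.
split=> //=.
- by move=> t /t3 t30; rewrite divr_gt0.
- by move=> t t0; rewrite divr_ge0// ltW// t3.
- move=> t t0; rewrite mulrACA -invfM ler_pdivrMr ?mulr_gt0 ?t3//; nra.
- move=> t /t3n t30; rewrite mul0r le_eqVlt; apply/orP; left; apply/eqP; field.
  exact: t30.
- by move=> t /t3n t30; field.
- move=> t /t3n t30; rewrite mul0r subr0 le_eqVlt; apply/orP; left; apply/eqP; field.
  exact: t30.
- move=> t t0.
  have dV := is_deriveV (f := fun s : R => s + 3) (t3n t t0) (d3 t).
  apply: (is_derive_eq (is_deriveZ (2 : R) dV)).
  by rewrite /GRing.scale /= mulr1 mulrN.
- move=> t t0.
  have -> : (fun s : R => (s + 3) ^+ 2 / 9) =
      (9^-1 \*: ((fun s : R => s + 3) * (fun s : R => s + 3))).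
    by apply/funext => s; rewrite expr2 mulrC.
  apply: (is_derive_eq (is_deriveZ (9^-1 : R) (is_deriveM (d3 t) (d3 t)))).
  have := t3n t t0; rewrite /GRing.scale /= => t30.
  by field.
- move=> t t0; apply: cvgN; apply: cvgM; first exact: cvg_cst.
  have c3 : s + 3 @[s --> t] --> t + 3 by apply: cvgD; [exact: cvg_id|exact: cvg_cst].
  apply: cvgV; first by rewrite expf_neq0// t3n.
  by under eq_fun do rewrite expr2; rewrite expr2; apply: cvgM.
- by move=> t /t3 t30; rewrite divr_gt0// exprn_gt0.
- by rewrite add0r; field.
- by move=> t /t3n t30; field.
Qed.

End Schemes.

(** * The convergence rate *)

Section Rate.
Context {R : realType} {n ng : nat}.
Context (f : 'rV[R]_n -> R) (g : 'I_ng -> 'rV[R]_n -> R) (p : parameters R).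
Context (eps : R) (x u up um udot : R -> 'rV[R]_n) (lam Lam : 'I_ng -> R -> R).
Context (xstar : 'rV[R]_n) (lambdastar : 'I_ng -> R).
Hypothesis f_smooth : smooth 1 f.
Hypothesis g_smooth : forall i, exists L : R, smooth L (g i).
Hypothesis g_concave : forall i, concave_fun (g i).
Hypothesis xstar_min : minimizer_over f (feasible g) xstar.
Hypothesis kkt : KKT f g xstar lambdastar.

Let xstar_feasible i : 0 <= g i xstar.
Proof. by have [h _] := xstar_min; exact: h. Qed.

(** The Lagrangian [f - sum_i lambdastar i * g i] is convex, with a
    vanishing gradient at [xstar]. *)
Lemma suboptimality_ge (m : R) y : 0 <= m -> strongly_convex m f ->
  \sum_(i < ng) g i y * lambdastar i <= f y - f xstar.
Proof.
move=> m0 cf; have [l0 gradf slack] := kkt.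
have := strongly_convex_grad y cf ((proj1 f_smooth) xstar).
have := mulr_ge0 m0 (dotrr_ge0 (y - xstar)).
suff : \sum_(i < ng) g i y * lambdastar i <= dotr (grad f xstar) (y - xstar) by lra.
rewrite gradf dotr_suml; apply: ler_sum => i _.
have [L [dg _]] := g_smooth i.
have := ler_wpM2l (l0 i) (concave_grad y (g_concave i) (dg xstar)).
by have := slack i; lra.
Qed.

Lemma convergence_rate (m : R) (da r : R -> R) (t : R) :
  lyapunov_parameters m p da r -> strongly_convex m f -> 0 <= eps < 1 ->
  inclusion f g p eps x u up um udot lam Lam -> um 0 = 0 -> 0 <= t ->
  (\sum_(i < ng) Num.min 0 (g i (x 0)) * lambdastar i) * rate p t
    <= f (x t) - f xstar
    <= (alpha p 0 ^+ 2 / 2 * enorm (x 0 - xstar) ^+ 2 + (f (x 0) - f xstar))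
       * rate p t.
Proof.
move=> par cf eps01 traj um0 t0.
have r0 := r_gt0 par t0; rewrite (rate_r par t0); apply/andP; split.
  apply: le_trans (suboptimality_ge (x t) (modulus_ge0 par) cf).
  rewrite ler_pdivrMr// mulr_suml; apply: ler_sum => i _.
  have [l0 _ _] := kkt.
  have := constraint_decay traj par g_smooth g_concave i t0.
  by move=> /(ler_wpM2l (l0 i)); lra.
rewrite ler_pdivlMr//.
have := energy_decay traj par f_smooth cf g_smooth g_concave xstar_feasible eps01 t0.
rewrite {2}/energy /mixed um0 addr0 dotrZl dotrZr enorm_sqr => decay.
have : f (x t) - f xstar <= energy f p x xstar (up t) t.
  by rewrite /energy lerDr divr_ge0// dotrr_ge0.
move=> /(ler_wpM2l (ltW r0)); lra.
Qed.

End Rate.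

Theorem theorem2 (R : realType) (n ng : nat)
  (f : 'rV[R]_n -> R) (g : 'I_ng -> 'rV[R]_n -> R)
  (p : parameters R) (eps : R)
  (x u up um udot : R -> 'rV[R]_n) (lam Lam : 'I_ng -> R -> R)
  (xstar : 'rV[R]_n) (lambdastar : 'I_ng -> R) :
  coercive f -> smooth 1 f ->
  (forall i, exists L : R, smooth L (g i)) ->
  (forall i, concave_fun (g i)) ->
  compact (feasible g) -> slater g ->
  0 <= eps < 1 ->
  admissible f p ->
  inclusion f g p eps x u up um udot lam Lam ->
  um 0 = 0 ->
  minimizer_over f (feasible g) xstar ->
  KKT f g xstar lambdastar ->
  forall t : R, 0 <= t ->
    (\sum_(i < ng) Num.min 0 (g i (x 0)) * lambdastar i) * rate p t
      <= f (x t) - f xstar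
      <= (alpha p 0 ^+ 2 / 2 * enorm (x 0 - xstar) ^+ 2 + (f (x 0) - f xstar))
         * rate p t.
Proof.
move=> _ fs gs gc _ _ eps01 adm traj um0 minx kkt t t0.
case: adm => [[mu [mu0 cf pE]]|[cf pE]]; last first.
  subst p; exact: (convergence_rate fs gs gc minx kkt nesterov_varying_lyapunov
    (convex_strongly_convex cf) eps01 traj um0 t0).
case: pE => pE; subst p.
  exact: (convergence_rate fs gs gc minx kkt (heavy_ball_lyapunov mu0)
    cf eps01 traj um0 t0).
case: n => [|n'] in f g x u up um udot xstar fs gs gc cf traj um0 minx kkt *.
  (* In dimension zero [mu] may exceed 1 and then [beta] is negative, but the
     space is a point. *)
  have eq_xstar y : y = xstar by apply/rowP => -[].
  have [l0 _ _] := kkt.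
  rewrite !(eq_xstar (x _)) !subrr /enorm /dotr big_ord0 sqrtr0 expr0n /=.
  rewrite mulr0 addr0 mul0r lexx andbT mulr_le0_ge0 ?expR_ge0//.
  by apply: sumr_le0 => i _; rewrite mulr_le0_ge0// ge_min lexx.
have mu1 : 0 < mu <= 1 by rewrite mu0 (smooth_strongly_convex_le1 _ fs cf).
exact: (convergence_rate fs gs gc minx kkt (nesterov_constant_lyapunov mu1)
  cf eps01 traj um0 t0).
Qed.
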